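(* Let $(E_6)^\gamma=\{\alpha\in E_6\mid\gamma\alpha=\alpha\gamma\}$. Then there is an isomorphism of groups $$(E_6)^\gamma\cong(Sp(1)\times SU(6))/\mathbb Z_2,\qquad\mathbb Z_2=\{(1,E),(-1,-E)\}.$$
   Context: $\mathbb H$ is the field of quaternions with basis $1,e_1,e_2,e_3$; the Cayley algebra is $\mathfrak C=\mathbb H\oplus\mathbb He_4$ with $(m+ae_4)(n+be_4)=(mn-\overline b a)+(a\overline n+bm)e_4$, $\overline{m+ae_4}=\overline m-ae_4$. $\mathfrak J=\{X\in M(3,\mathfrak C)\mid X^*=X\}$ with $X\circ Y=\frac12(XY+YX)$, $\mathrm{tr}(X)$ the sum of diagonal entries, $(X,Y)=\mathrm{tr}(X\circ Y)$, $X\times Y=\frac12(2X\circ Y-\mathrm{tr}(X)Y-\mathrm{tr}(Y)X+(\mathrm{tr}(X)\mathrm{tr}(Y)-(X,Y))E)$, $\det X=\frac13(X,X\times X)$. $\mathfrak J^{\mathbb C}=\{X_1+iX_2\mid X_j\in\mathfrak J\}$ is the complexification with these operations extended complex (multi)linearly, $\tau(X_1+iX_2)=X_1-iX_2$, $\langle X,Y\rangle=(\tau X,Y)$. $E_6$ is the group of $\mathbb C$-linear isomorphisms $\alpha$ of $\mathfrak J^{\mathbb C}$ with $\det(\alpha X)=\det X$ and $\langle\alpha X,\alpha Y\rangle=\langle X,Y\rangle$. The involution $\gamma(m+ae_4)=m-ae_4$ of $\mathfrak C$ acts entrywise on $\mathfrak J$ and is extended $\mathbb C$-linearly to $\mathfrak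 J^{\mathbb C}$; this gives $\gamma\in E_6$. $Sp(1)$ is the group of unit quaternions and $SU(6)$ the special unitary group; $E$ is the unit matrix. *)

(* Defs.v *)
From HB Require Import structures.
From mathcomp Require Import all_boot all_order all_algebra.
From mathcomp Require Import boolp reals complex.
From mathcomp Require Import ring.

Set Implicit Arguments.
Unset Strict Implicit.
Unset Printing Implicit Defensive.

Import Order.TTheory GRing.Theory Num.Theory.
Local Open Scope ring_scope.
Local Open Scope quotient_scope.
Local Open Scope complex_scope.
Local Open Scope sesquilinear_scope.

HB.mixin Record isConjClosed (G : groupType) (S : {pred G}) := {
  conj_closed : forall x y : G, x \in S -> (x ^ y)%g \in S
}.

#[short(type="normalSubgroup")]
HB.structure Definition NormalSubgroup (G : groupType) :=
  {S of isConjClosed G S & GroupClosed G S}.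

Section QuotientGroup.
Local Open Scope group_scope.
Variables (G : groupType) (N : normalSubgroup G).

Definition coset_rel : rel G := fun x y => (x^-1 * y)%g \in N.

Lemma coset_rel_refl : reflexive coset_rel.
Proof. by move=> x; rewrite /coset_rel mulVg gpred1. Qed.

Lemma coset_rel_sym : symmetric coset_rel.
Proof. by move=> x y; rewrite /coset_rel -gpredV invgM invgK. Qed.

Lemma coset_rel_trans : transitive coset_rel.
Proof.
move=> y x z; rewrite /coset_rel => xy yz.
by rewrite -(mulgK y x^-1) -mulgA gpredM // -(mulgVK y x^-1) mulgK.
Qed.

Canonical coset_equiv :=
  EquivRel coset_rel coset_rel_refl coset_rel_sym coset_rel_trans.

Definition quot_group := {eq_quot coset_rel}.

HB.instance Definition _ := Choice.on quot_group.
HB.instance Definition _ := EqQuotient.on quot_group.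

Definition quot_one : quot_group := \pi_quot_group 1.
Definition quot_inv (x : quot_group) : quot_group :=
  \pi_quot_group (repr x)^-1.
Definition quot_mul (x y : quot_group) : quot_group :=
  \pi_quot_group (repr x * repr y).

Lemma quot_piP (x y : G) :
  reflect (\pi_quot_group x = \pi_quot_group y) ((x^-1 * y)%g \in N).
Proof. by apply: (iffP idP) => [h|/eqmodP//]; apply/eqmodP. Qed.

Lemma quot_mul_pi (x y : G) :
  quot_mul (\pi_quot_group x) (\pi_quot_group y) = \pi_quot_group (x * y).
Proof.
rewrite /quot_mul; apply/quot_piP.
set x' := repr _; set y' := repr _.
have hx : (x'^-1 * x \in N) by apply/quot_piP; rewrite reprK.
have hy : (y'^-1 * y \in N) by apply/quot_piP; rewrite reprK.
have -> : (x' * y')^-1 * (x * y) = (y'^-1 * y) * ((x'^-1 * x) ^ y).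
  by rewrite conjgE invgM !mulgA mulgK.
by rewrite gpredM ?conj_closed.
Qed.

Lemma quot_inv_pi (x : G) :
  quot_inv (\pi_quot_group x) = \pi_quot_group x^-1.
Proof.
rewrite /quot_inv; apply/quot_piP; set x' := repr _; rewrite invgK.
have hx : (x^-1 * x' \in N) by apply/quot_piP; rewrite reprK.
have -> : x' * x^-1 = (x^-1 * x') ^ x^-1.
  by rewrite conjgE invgK !mulgA mulgV mul1g.
by rewrite conj_closed.
Qed.

Lemma quot_mulA : associative quot_mul.
Proof.
elim/quotW => x; elim/quotW => y; elim/quotW => z.
rewrite (quot_mul_pi y z) (quot_mul_pi x y) (quot_mul_pi x (y * z)).
by rewrite (quot_mul_pi (x * y) z) mulgA.
Qed.

Lemma quot_mul1x : left_id quot_one quot_mul.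
Proof. by elim/quotW => x; rewrite quot_mul_pi mul1g. Qed.

Lemma quot_mulx1 : right_id quot_one quot_mul.
Proof. by elim/quotW => x; rewrite quot_mul_pi mulg1. Qed.

Lemma quot_mulVx : left_inverse quot_one quot_inv quot_mul.
Proof. by elim/quotW => x; rewrite (quot_inv_pi x) (quot_mul_pi _ _) mulVg. Qed.

Lemma quot_mulxV : right_inverse quot_one quot_inv quot_mul.
Proof. by elim/quotW => x; rewrite (quot_inv_pi x) (quot_mul_pi _ _) mulgV. Qed.

HB.instance Definition _ := isGroup.Build quot_group
  quot_mulA quot_mul1x quot_mulx1 quot_mulVx quot_mulxV.

End QuotientGroup.

Definition group_isomorphic (G H : groupType) : Prop :=
  exists f : {multiplicative G -> H}, bijective f.

Section Centralizer.
Local Open Scope group_scope.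
Variables (G : groupType) (g : G).

Definition centralizer : {pred G} := [pred a | g * a == a * g].

Lemma centralizer_closed : group_closed centralizer.
Proof.
split=> [|a b]; rewrite !inE ?mulg1 ?mul1g // => /eqP ga /eqP gb.
have gbV : g * b^-1 = b^-1 * g.
  by apply: (@mulgI _ b); rewrite mulgA -gb mulgK mulgA mulgV mul1g.
by rewrite mulgA ga -mulgA gbV mulgA.
Qed.

End Centralizer.

Section LinearAutomorphisms.
Variables (K : nzRingType) (V : lmodType K).

Definition lin_autP : pred (V -> V) := fun f => `[< linear f /\ bijective f >].

Record lin_aut :=
  LinAut { lin_aut_fun :> V -> V; _ : lin_autP lin_aut_fun }.

HB.instance Definition _ := [isSub for lin_aut_fun].
HB.instance Definition _ := [Choice of lin_aut by <:].

Lemma lin_aut_linear (f : lin_aut) : linear f.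
Proof. by have /asboolP[] := valP f. Qed.

Lemma lin_aut_bij (f : lin_aut) : bijective f.
Proof. by have /asboolP[] := valP f. Qed.

Lemma lin_aut_one_subproof : lin_autP idfun.
Proof. by apply/asboolP; split=> //; exists idfun. Qed.

Lemma lin_aut_mul_subproof (f g : lin_aut) : lin_autP (f \o g).
Proof.
apply/asboolP; split; last exact: bij_comp (lin_aut_bij f) (lin_aut_bij g).
by move=> a u v /=; rewrite !lin_aut_linear.
Qed.

Lemma lin_aut_ex_inv (f : lin_aut) :
  exists g : V -> V, cancel f g /\ cancel g f.
Proof. by case: (lin_aut_bij f) => g fK gK; exists g. Qed.

Definition lin_aut_invfun (f : lin_aut) : V -> V :=
  projT1 (cid (lin_aut_ex_inv f)).

Lemma lin_aut_K (f : lin_aut) : cancel f (lin_aut_invfun f).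
Proof. by rewrite /lin_aut_invfun; case: cid => g []. Qed.

Lemma lin_aut_VK (f : lin_aut) : cancel (lin_aut_invfun f) f.
Proof. by rewrite /lin_aut_invfun; case: cid => g []. Qed.

Lemma lin_aut_inv_subproof (f : lin_aut) : lin_autP (lin_aut_invfun f).
Proof.
apply/asboolP; split; last first.
  exists f; [exact: lin_aut_VK | exact: lin_aut_K].
move=> a u v; apply: (can_inj (lin_aut_K f)).
by rewrite lin_aut_linear !lin_aut_VK.
Qed.

Definition lin_aut_one : lin_aut := Sub idfun lin_aut_one_subproof.
Definition lin_aut_mul (f g : lin_aut) : lin_aut :=
  Sub (f \o g) (lin_aut_mul_subproof f g).
Definition lin_aut_inv (f : lin_aut) : lin_aut :=
  Sub (lin_aut_invfun f) (lin_aut_inv_subproof f).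

Lemma lin_aut_mulA : associative lin_aut_mul.
Proof. by move=> f g h; apply: val_inj. Qed.

Lemma lin_aut_mul1x : left_id lin_aut_one lin_aut_mul.
Proof. by move=> f; apply: val_inj. Qed.

Lemma lin_aut_mulx1 : right_id lin_aut_one lin_aut_mul.
Proof. by move=> f; apply: val_inj. Qed.

Lemma lin_aut_mulVx : left_inverse lin_aut_one lin_aut_inv lin_aut_mul.
Proof. by move=> f; apply/val_inj/funext => x; apply: lin_aut_K. Qed.

Lemma lin_aut_mulxV : right_inverse lin_aut_one lin_aut_inv lin_aut_mul.
Proof. by move=> f; apply/val_inj/funext => x; apply: lin_aut_VK. Qed.

HB.instance Definition _ := isGroup.Build lin_aut
  lin_aut_mulA lin_aut_mul1x lin_aut_mulx1 lin_aut_mulVx lin_aut_mulxV.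

End LinearAutomorphisms.

Section Complexification.
Variable R : realType.

(* [Cplx u v] stands for u + iv. *)
Record complexification (V : Type) := Cplx { cplx_re : V; cplx_im : V }.

Definition complexification_pair V (x : complexification V) :=
  (cplx_re x, cplx_im x).
Definition pair_complexification V (x : V * V) := Cplx x.1 x.2.

Lemma complexification_pairK V :
  cancel (@complexification_pair V) (@pair_complexification V).
Proof. by case. Qed.

HB.instance Definition _ (V : choiceType) :=
  Choice.copy (complexification V) (can_type (@complexification_pairK V)).

Variable V : lmodType R.
Implicit Types x y z : complexification V.

Definition cplx_add x y :=
  Cplx (cplx_re x + cplx_re y) (cplx_im x + cplx_im y).
Definition cplx_opp x := Cplx (- cplx_re x) (- cplx_im x).
Definition cplx_zero : complexification V := Cplx 0 0.

Lemma cplx_addA : associative cplx_add.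
Proof. by move=> x y z; rewrite /cplx_add /= !addrA. Qed.
Lemma cplx_addC : commutative cplx_add.
Proof.
by move=> x y; rewrite /cplx_add (addrC (cplx_re x)) (addrC (cplx_im x)).
Qed.
Lemma cplx_add0 : left_id cplx_zero cplx_add.
Proof. by case=> u v; rewrite /cplx_add /= !add0r. Qed.
Lemma cplx_addN : left_inverse cplx_zero cplx_opp cplx_add.
Proof. by case=> u v; rewrite /cplx_add /= !addNr. Qed.

HB.instance Definition _ := GRing.isZmodule.Build (complexification V)
  cplx_addA cplx_addC cplx_add0 cplx_addN.

Definition cplx_scale (a : R[i]) x : complexification V :=
  Cplx (complex.Re a *: cplx_re x - complex.Im a *: cplx_im x)
       (complex.Re a *: cplx_im x + complex.Im a *: cplx_re x).

Lemma cplx_scaleA a b x :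
  cplx_scale a (cplx_scale b x) = cplx_scale (a * b) x.
Proof.
case: a b x => a1 a2 [b1 b2] [u v]; rewrite /cplx_scale /=; congr Cplx.
  rewrite !(scalerBr, scalerDr, scalerBl, scalerDl, scalerA) !opprD.
  by rewrite -!addrA; congr (_ + _); rewrite [RHS]addrC -addrA.
rewrite !(scalerBr, scalerDr, scalerBl, scalerDl, scalerA).
by rewrite -!addrA; congr (_ + _); rewrite [RHS]addrC -addrA.
Qed.
Lemma cplx_scale1 : left_id 1 cplx_scale.
Proof. by case=> u v; rewrite /cplx_scale /= !scale1r !scale0r subr0 addr0. Qed.
Lemma cplx_scaleDr : right_distributive cplx_scale +%R.
Proof.
move=> [a1 a2] [u v] [u' v']; rewrite /cplx_scale /=; congr Cplx => /=.
  by rewrite !scalerDr opprD addrACA.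
by rewrite !scalerDr addrACA.
Qed.
Lemma cplx_scaleDl x : {morph cplx_scale^~ x : a b / a + b}.
Proof.
case: x => u v [a1 a2] [b1 b2]; rewrite /cplx_scale /=; congr Cplx => /=.
  by rewrite !scalerDl opprD addrACA.
by rewrite !scalerDl addrACA.
Qed.

HB.instance Definition _ := GRing.Zmodule_isLmodule.Build R[i]
  (complexification V) cplx_scaleA cplx_scale1 cplx_scaleDr cplx_scaleDl.

Definition cplx_conj x : complexification V :=
  Cplx (cplx_re x) (- cplx_im x).

(* The complex (bi)linear extensions of real (bi)linear maps. *)
Definition cplx_ext (f : V -> V) x : complexification V :=
  Cplx (f (cplx_re x)) (f (cplx_im x)).

Definition cplx_ext2 (f : V -> V -> V) x y : complexification V :=
  Cplx (f (cplx_re x) (cplx_re y) - f (cplx_im x) (cplx_im y))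
       (f (cplx_re x) (cplx_im y) + f (cplx_im x) (cplx_re y)).

Definition cplx_extform (f : V -> V -> R) x y : R[i] :=
  (f (cplx_re x) (cplx_re y) - f (cplx_im x) (cplx_im y)) +i*
  (f (cplx_re x) (cplx_im y) + f (cplx_im x) (cplx_re y)).

End Complexification.

Section Quaternions.
Variable R : realType.

(* [Quat a b c d] stands for a + b e1 + c e2 + d e3, with e1 e2 = e3. *)
Record quat := Quat { quat0 : R; quat1 : R; quat2 : R; quat3 : R }.

Definition quat_tuple q := (quat0 q, quat1 q, quat2 q, quat3 q).
Definition tuple_quat (t : R * R * R * R) :=
  Quat t.1.1.1 t.1.1.2 t.1.2 t.2.
Lemma quat_tupleK : cancel quat_tuple tuple_quat.
Proof. by case. Qed.

HB.instance Definition _ := Choice.copy quat (can_type quat_tupleK).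

Implicit Types p q r : quat.

Definition quat_add p q := Quat (quat0 p + quat0 q) (quat1 p + quat1 q)
  (quat2 p + quat2 q) (quat3 p + quat3 q).
Definition quat_opp p :=
  Quat (- quat0 p) (- quat1 p) (- quat2 p) (- quat3 p).
Definition quat_zero := Quat 0 0 0 0.

Lemma quat_addA : associative quat_add.
Proof. by move=> [????] [????] [????]; congr Quat; apply: addrA. Qed.
Lemma quat_addC : commutative quat_add.
Proof. by move=> [????] [????]; congr Quat; apply: addrC. Qed.
Lemma quat_add0 : left_id quat_zero quat_add.
Proof. by move=> [????]; congr Quat; apply: add0r. Qed.
Lemma quat_addN : left_inverse quat_zero quat_opp quat_add.
Proof. by move=> [????]; congr Quat; apply: addNr. Qed.

HB.instance Definition _ :=
  GRing.isZmodule.Build quat quat_addA quat_addC quat_add0 quat_addN.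

Definition quat_one := Quat 1 0 0 0.
Definition quat_mul p q :=
  let: Quat a b c d := p in let: Quat a' b' c' d' := q in
  Quat (a * a' - b * b' - c * c' - d * d')
       (a * b' + b * a' + c * d' - d * c')
       (a * c' - b * d' + c * a' + d * b')
       (a * d' + b * c' - c * b' + d * a').

Lemma quat_mulA : associative quat_mul.
Proof. by move=> [????] [????] [????]; congr Quat => /=; ring. Qed.
Lemma quat_mul1 : left_id quat_one quat_mul.
Proof. by move=> [????]; congr Quat => /=; ring. Qed.
Lemma quat_1mul : right_id quat_one quat_mul.
Proof. by move=> [????]; congr Quat => /=; ring. Qed.
Lemma quat_mulDl : left_distributive quat_mul +%R.
Proof. by move=> [????] [????] [????]; congr Quat => /=; ring. Qed.
Lemma quat_mulDr : right_distributive quat_mul +%R.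
Proof. by move=> [????] [????] [????]; congr Quat => /=; ring. Qed.
Lemma quat_oner_neq0 : quat_one != 0.
Proof. by apply/eqP => -[/eqP]; rewrite oner_eq0. Qed.

HB.instance Definition _ := GRing.Zmodule_isNzRing.Build quat
  quat_mulA quat_mul1 quat_1mul quat_mulDl quat_mulDr quat_oner_neq0.

Definition quat_scale (a : R) q :=
  Quat (a * quat0 q) (a * quat1 q) (a * quat2 q) (a * quat3 q).

Lemma quat_scaleA a b q : quat_scale a (quat_scale b q) = quat_scale (a * b) q.
Proof. by case: q => *; congr Quat; apply: mulrA. Qed.
Lemma quat_scale1 : left_id 1 quat_scale.
Proof. by move=> [????]; congr Quat; apply: mul1r. Qed.
Lemma quat_scaleDr : right_distributive quat_scale +%R.
Proof. by move=> a [????] [????]; congr Quat; apply: mulrDr. Qed.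
Lemma quat_scaleDl q : {morph quat_scale^~ q : a b / a + b}.
Proof. by move=> a b; congr Quat; apply: mulrDl. Qed.

HB.instance Definition _ := GRing.Zmodule_isLmodule.Build R quat
  quat_scaleA quat_scale1 quat_scaleDr quat_scaleDl.

Definition quat_conj q := Quat (quat0 q) (- quat1 q) (- quat2 q) (- quat3 q).

Definition quat_norm q : R :=
  Num.sqrt (quat0 q ^+ 2 + quat1 q ^+ 2 + quat2 q ^+ 2 + quat3 q ^+ 2).

Definition sp1P : pred quat := fun q => quat_norm q == 1.

Lemma sp1_eq q : sp1P q =
  (quat0 q ^+ 2 + quat1 q ^+ 2 + quat2 q ^+ 2 + quat3 q ^+ 2 == 1).
Proof.
rewrite /sp1P /quat_norm -[1 in LHS]sqrtr1.
by rewrite eqr_sqrt ?ler01 // !addr_ge0 // sqr_ge0.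
Qed.

Record Sp1 := MkSp1 { sp1_val : quat; _ : sp1P sp1_val }.

HB.instance Definition _ := [isSub for sp1_val].
HB.instance Definition _ := [Choice of Sp1 by <:].

Implicit Types x y z : Sp1.

Lemma sp1_one_subproof : sp1P 1.
Proof. by rewrite sp1_eq /= expr1n expr0n !addr0. Qed.
Lemma sp1_mul_subproof x y : sp1P (val x * val y).
Proof.
case: x y => [[a b c d] /= px] [[a' b' c' d'] /= py]; move: px py.
rewrite !sp1_eq /= => /eqP px /eqP py; apply/eqP.
by rewrite -[RHS](mulr1 1) -{1}px -py; ring.
Qed.
Lemma sp1_inv_subproof x : sp1P (quat_conj (val x)).
Proof. by case: x => q; rewrite /= !sp1_eq /= !sqrrN. Qed.

Definition sp1_one : Sp1 := Sub 1 sp1_one_subproof.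
Definition sp1_mul x y : Sp1 := Sub (val x * val y) (sp1_mul_subproof x y).
Definition sp1_inv x : Sp1 := Sub (quat_conj (val x)) (sp1_inv_subproof x).

Lemma sp1_mulA : associative sp1_mul.
Proof. by move=> x y z; apply: val_inj; rewrite /= mulrA. Qed.
Lemma sp1_mul1x : left_id sp1_one sp1_mul.
Proof. by move=> x; apply: val_inj; rewrite /= mul1r. Qed.
Lemma sp1_mulx1 : right_id sp1_one sp1_mul.
Proof. by move=> x; apply: val_inj; rewrite /= mulr1. Qed.
Lemma sp1_mulVx : left_inverse sp1_one sp1_inv sp1_mul.
Proof.
move=> [[a b c d] px]; apply: val_inj => /=; move: px; rewrite sp1_eq /=.
by move=> /eqP px; congr Quat; rewrite -?px /=; ring.
Qed.
Lemma sp1_mulxV : right_inverse sp1_one sp1_inv sp1_mul.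
Proof.
move=> [[a b c d] px]; apply: val_inj => /=; move: px; rewrite sp1_eq /=.
by move=> /eqP px; congr Quat; rewrite -?px /=; ring.
Qed.

HB.instance Definition _ := isGroup.Build Sp1
  sp1_mulA sp1_mul1x sp1_mulx1 sp1_mulVx sp1_mulxV.

Lemma sp1_N1_subproof : sp1P (- 1).
Proof. by rewrite sp1_eq /= sqrrN oppr0 expr1n expr0n !addr0. Qed.

Definition sp1_N1 : Sp1 := Sub (- 1) sp1_N1_subproof.

End Quaternions.

Section SpecialUnitary.
Variables (C : numClosedFieldType) (n : nat).

Definition suP : pred 'M[C]_n := fun A => (A \is unitarymx) && (\det A == 1).

Record SU := MkSU { su_val : 'M[C]_n; _ : suP su_val }.

HB.instance Definition _ := [isSub for su_val].
HB.instance Definition _ := [Choice of SU by <:].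

Implicit Types A B : SU.

Lemma su_one_subproof : suP 1%:M.
Proof.
rewrite /suP det1 eqxx andbT; apply/unitarymxP.
by rewrite trmx1 map_mx1 mulmx1.
Qed.
Lemma su_mul_subproof A B : suP (val A *m val B).
Proof.
case: A B => [A /andP[uA /eqP dA]] [B /andP[uB /eqP dB]] /=.
by rewrite /suP mul_unitarymx // det_mulmx dA dB mulr1 eqxx.
Qed.
Lemma su_inv_subproof A : suP ((val A) ^t* ).
Proof.
case: A => [A /andP[uA /eqP dA]] /=.
by rewrite /suP trmxC_unitary uA /= det_map_mx det_tr dA rmorph1.
Qed.

Definition su_one : SU := Sub 1%:M su_one_subproof.
Definition su_mul A B : SU := Sub (val A *m val B) (su_mul_subproof A B).
Definition su_inv A : SU := Sub ((val A) ^t* ) (su_inv_subproof A).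

Lemma su_mulA : associative su_mul.
Proof. by move=> A B D; apply: val_inj; rewrite /= mulmxA. Qed.
Lemma su_mul1x : left_id su_one su_mul.
Proof. by move=> A; apply: val_inj; rewrite /= mul1mx. Qed.
Lemma su_mulx1 : right_id su_one su_mul.
Proof. by move=> A; apply: val_inj; rewrite /= mulmx1. Qed.
Lemma su_mulxV : right_inverse su_one su_inv su_mul.
Proof.
by move=> A; apply: val_inj; have /andP[/unitarymxP uA _] := valP A.
Qed.
Lemma su_mulVx : left_inverse su_one su_inv su_mul.
Proof.
by move=> A; apply: val_inj; apply: mulmx1C; apply: (congr1 val (su_mulxV A)).
Qed.

HB.instance Definition _ := isGroup.Build SU
  su_mulA su_mul1x su_mulx1 su_mulVx su_mulxV.

End SpecialUnitary.

Section MinusIdentity.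
Variable C : numClosedFieldType.

Lemma su6_N1_subproof : suP (- 1%:M : 'M[C]_6).
Proof.
rewrite /suP -scaleN1r detZ det1 mulr1 -signr_odd expr0 eqxx andbT.
apply/unitarymxP; rewrite scaleN1r linearN /= map_mxN trmx1 map_mx1.
by rewrite mulNmx mulmxN opprK mulmx1.
Qed.

Definition su6_N1 : SU C 6 := Sub (- 1%:M) su6_N1_subproof.

End MinusIdentity.

Section Z2.
Variable R : realType.

Local Notation Sp1xSU6 := (Sp1 R * SU R[i] 6)%type.

Definition Z2 : {pred Sp1xSU6} :=
  pred2 (1%g, 1%g) (sp1_N1 R, su6_N1 R[i]).

Let N1 : Sp1xSU6 := (sp1_N1 R, su6_N1 R[i]).

Lemma N1_sqr : (N1 * N1 = 1)%g.
Proof.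
congr pair; apply: val_inj => /=; first by rewrite mulrNN mulr1.
by rewrite mulNmx mulmxN opprK mulmx1.
Qed.

Lemma N1_comm (x : Sp1xSU6) : (x * N1 = N1 * x)%g.
Proof.
case: x => p A; congr pair; apply: val_inj => /=.
  by rewrite mulrN mulNr mulr1 mul1r.
by rewrite mulNmx mulmxN mulmx1 mul1mx.
Qed.

Lemma Z2_mulg : mulg_closed Z2.
Proof.
move=> x y; rewrite !inE => /orP[]/eqP-> /orP[]/eqP->;
  by rewrite ?mul1g ?mulg1 ?eqxx ?orbT // -/N1 N1_sqr eqxx.
Qed.
Lemma Z2_one : (1 : Sp1xSU6)%g \in Z2.
Proof. by rewrite !inE eqxx. Qed.
Lemma Z2_inv : invg_closed Z2.
Proof.
move=> x; rewrite !inE => /orP[]/eqP->; first by rewrite invg1 eqxx.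
by rewrite -/N1 (mulg1_eq N1_sqr) eqxx orbT.
Qed.
Lemma Z2_conj (x y : Sp1xSU6) : x \in Z2 -> (x ^ y)%g \in Z2.
Proof.
rewrite !inE => /orP[]/eqP->; first by rewrite conj1g eqxx.
by rewrite -/N1 conjgE -N1_comm mulgA mulVg mul1g eqxx orbT.
Qed.

HB.instance Definition _ := isMulClosed.Build Sp1xSU6 Z2 Z2_mulg.
HB.instance Definition _ := isMul1Closed.Build Sp1xSU6 Z2 Z2_one.
HB.instance Definition _ := isInvClosed.Build Sp1xSU6 Z2 Z2_inv.
HB.instance Definition _ := isConjClosed.Build Sp1xSU6 Z2 Z2_conj.

End Z2.

Arguments Z2 : clear implicits.

Section CayleyAlgebra.
Variable R : realType.

(* [Cay m a] stands for m + a e4. *)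
Record cayley := Cay { cay1 : quat R; cay2 : quat R }.

Definition cayley_pair x := (cay1 x, cay2 x).
Definition pair_cayley (t : quat R * quat R) := Cay t.1 t.2.
Lemma cayley_pairK : cancel cayley_pair pair_cayley.
Proof. by case. Qed.

HB.instance Definition _ := Choice.copy cayley (can_type cayley_pairK).

Implicit Types x y z : cayley.

Definition cay_add x y := Cay (cay1 x + cay1 y) (cay2 x + cay2 y).
Definition cay_opp x := Cay (- cay1 x) (- cay2 x).
Definition cay_zero := Cay 0 0.

Lemma cay_addA : associative cay_add.
Proof. by move=> [??] [??] [??]; congr Cay; apply: addrA. Qed.
Lemma cay_addC : commutative cay_add.
Proof. by move=> [??] [??]; congr Cay; apply: addrC. Qed.
Lemma cay_add0 : left_id cay_zero cay_add.
Proof. by move=> [??]; congr Cay; apply: add0r. Qed.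
Lemma cay_addN : left_inverse cay_zero cay_opp cay_add.
Proof. by move=> [??]; congr Cay; apply: addNr. Qed.

HB.instance Definition _ :=
  GRing.isZmodule.Build cayley cay_addA cay_addC cay_add0 cay_addN.

Definition cay_scale (a : R) x := Cay (a *: cay1 x) (a *: cay2 x).

Lemma cay_scaleA a b x : cay_scale a (cay_scale b x) = cay_scale (a * b) x.
Proof. by case: x => *; congr Cay; apply: scalerA. Qed.
Lemma cay_scale1 : left_id 1 cay_scale.
Proof. by move=> [??]; congr Cay; apply: scale1r. Qed.
Lemma cay_scaleDr : right_distributive cay_scale +%R.
Proof. by move=> a [??] [??]; congr Cay; apply: scalerDr. Qed.
Lemma cay_scaleDl x : {morph cay_scale^~ x : a b / a + b}.
Proof. by move=> a b; congr Cay; apply: scalerDl. Qed.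

HB.instance Definition _ := GRing.Zmodule_isLmodule.Build R cayley
  cay_scaleA cay_scale1 cay_scaleDr cay_scaleDl.

Definition cay_one := Cay 1 0.

Definition cay_mul x y :=
  let: Cay m a := x in let: Cay n b := y in
  Cay (m * n - quat_conj b * a) (a * quat_conj n + b * m).

Definition cay_conj x := Cay (quat_conj (cay1 x)) (- cay2 x).

Definition cay_re x : R := quat0 (cay1 x).

Definition cay_gamma x := Cay (cay1 x) (- cay2 x).

Lemma quat_conjM (p q : quat R) :
  quat_conj (p * q) = quat_conj q * quat_conj p.
Proof. by case: p q => [????] [????]; congr Quat => /=; ring. Qed.
Lemma quat_conjD (p q : quat R) :
  quat_conj (p + q) = quat_conj p + quat_conj q.
Proof. by case: p q => [????] [????]; congr Quat => /=; ring. Qed.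
Lemma quat_conjN (p : quat R) : quat_conj (- p) = - quat_conj p.
Proof. by []. Qed.
Lemma quat_conjK : involutive (@quat_conj R).
Proof. by case=> *; rewrite /quat_conj /= !opprK. Qed.

Lemma cay_conjM x y : cay_conj (cay_mul x y) = cay_mul (cay_conj y) (cay_conj x).
Proof.
case: x y => [m a] [n b]; congr Cay => /=.
  rewrite quat_conjD quat_conjN !quat_conjM quat_conjK quat_conjN.
  by rewrite mulrN mulNr opprK.
by rewrite quat_conjK opprD !mulNr addrC.
Qed.
Lemma cay_conjD : {morph cay_conj : x y / x + y}.
Proof. by case=> [m a] [n b]; congr Cay; rewrite /= ?quat_conjD ?opprD. Qed.
Lemma cay_conj0 : cay_conj 0 = 0.
Proof. by congr Cay; rewrite /= ?oppr0 // /quat_conj /= oppr0. Qed.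
Lemma cay_conjN : {morph cay_conj : x / - x}.
Proof. by []. Qed.
Lemma cay_conjZ a : {morph cay_conj : x / a *: x}.
Proof.
case=> [[m0 m1 m2 m3] [a0 a1 a2 a3]].
by congr Cay; congr Quat; rewrite /= ?mulrN.
Qed.
Lemma cay_gammaM : {morph cay_gamma : x y / cay_mul x y}.
Proof.
case=> [m a] [n b]; congr Cay => /=.
  by rewrite quat_conjN mulNr mulrN opprK.
by rewrite opprD !mulNr.
Qed.
Lemma cay_gammaD : {morph cay_gamma : x y / x + y}.
Proof. by case=> [m a] [n b]; congr Cay; rewrite /= ?opprD. Qed.
Lemma cay_gamma0 : cay_gamma 0 = 0.
Proof. by congr Cay; rewrite /= oppr0. Qed.
Lemma cay_gammaZ a : {morph cay_gamma : x / a *: x}.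
Proof. by case=> [m b]; congr Cay; rewrite /= ?scalerN. Qed.
Lemma cay_gamma_conj x : cay_gamma (cay_conj x) = cay_conj (cay_gamma x).
Proof. by []. Qed.
Lemma cay_gammaK : involutive cay_gamma.
Proof. by case=> m a; rewrite /cay_gamma /= opprK. Qed.

(* The Cayley algebra is not associative, hence not a ring in the sense of the
   library, and the product of matrices over it has to be defined by hand. *)
Implicit Types X Y : 'M[cayley]_3.

Definition cay_mulmx X Y : 'M[cayley]_3 :=
  \matrix_(i, j) \sum_k cay_mul (X i k) (Y k j).

Definition cay_adjmx X : 'M[cayley]_3 := map_mx cay_conj X^T.

Definition cay_scalemx (a : R) X : 'M[cayley]_3 :=
  map_mx (fun x => a *: x) X.

Lemma cay_adjmxM X Y :
  cay_adjmx (cay_mulmx X Y) = cay_mulmx (cay_adjmx Y) (cay_adjmx X).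
Proof.
apply/matrixP => i j; rewrite !mxE (big_morph _ cay_conjD cay_conj0).
by apply: eq_bigr => k _; rewrite cay_conjM !mxE.
Qed.

Definition jordanP : {pred 'M[cayley]_3} := fun X => cay_adjmx X == X.

Lemma jordan_zmod_closed : zmod_closed jordanP.
Proof.
split=> [|X Y]; rewrite !unfold_in.
  by apply/eqP/matrixP => i j; rewrite !mxE cay_conj0.
move=> /eqP hX /eqP hY; apply/eqP; rewrite -[in RHS]hX -[in RHS]hY.
by apply/matrixP => i j; rewrite !mxE cay_conjD cay_conjN.
Qed.

HB.instance Definition _ :=
  GRing.isZmodClosed.Build 'M[cayley]_3 jordanP jordan_zmod_closed.

Lemma jordan_scale_subproof a X : X \in jordanP -> cay_scalemx a X \in jordanP.
Proof.
rewrite !unfold_in => /eqP hX; apply/eqP; rewrite -[in RHS]hX.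
by apply/matrixP => i j; rewrite !mxE cay_conjZ.
Qed.

Lemma jordan_circ_subproof X Y : X \in jordanP -> Y \in jordanP ->
  cay_scalemx 2^-1 (cay_mulmx X Y + cay_mulmx Y X) \in jordanP.
Proof.
move=> hX hY; apply: jordan_scale_subproof; move: hX hY.
rewrite !unfold_in => /eqP hX /eqP hY; apply/eqP.
rewrite addrC; transitivity
  (cay_adjmx (cay_mulmx Y X) + cay_adjmx (cay_mulmx X Y)).
  by apply/matrixP => i j; rewrite !mxE cay_conjD.
by rewrite !cay_adjmxM hX hY addrC.
Qed.

Definition cay_idmx : 'M[cayley]_3 :=
  \matrix_(i, j) (if i == j then cay_one else 0).

Lemma jordan_id_subproof : cay_idmx \in jordanP.
Proof.
rewrite unfold_in; apply/eqP/matrixP => i j; rewrite !mxE eq_sym.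
case: (_ == _); last exact: cay_conj0.
by congr Cay; rewrite /= ?oppr0 // /quat_conj /= oppr0.
Qed.

Lemma jordan_gamma_subproof X :
  X \in jordanP -> map_mx cay_gamma X \in jordanP.
Proof.
rewrite !unfold_in => /eqP hX; apply/eqP; rewrite -[in RHS]hX.
by apply/matrixP => i j; rewrite !mxE cay_gamma_conj.
Qed.

End CayleyAlgebra.

Section ExceptionalJordanAlgebra.
Variable R : realType.

Record jordan :=
  Jordan { jordan_val : 'M[cayley R]_3; _ : jordan_val \in @jordanP R }.

HB.instance Definition _ := [isSub for jordan_val].
HB.instance Definition _ := [Choice of jordan by <:].
HB.instance Definition _ :=
  [SubChoice_isSubZmodule of jordan by <:].

Implicit Types X Y Z : jordan.

Definition jordan_scale (a : R) X : jordan :=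
  Sub (cay_scalemx a (val X)) (jordan_scale_subproof a (valP X)).

Lemma jordan_scaleA a b X :
  jordan_scale a (jordan_scale b X) = jordan_scale (a * b) X.
Proof. by apply/val_inj/matrixP => i j; rewrite !mxE scalerA. Qed.
Lemma jordan_scale1 : left_id 1 jordan_scale.
Proof. by move=> X; apply/val_inj/matrixP => i j; rewrite !mxE scale1r. Qed.
Lemma jordan_scaleDr : right_distributive jordan_scale +%R.
Proof.
by move=> a X Y; apply/val_inj/matrixP => i j; rewrite !mxE scalerDr.
Qed.
Lemma jordan_scaleDl X : {morph jordan_scale^~ X : a b / a + b}.
Proof.
by move=> a b; apply/val_inj/matrixP => i j; rewrite !mxE scalerDl.
Qed.

HB.instance Definition _ := GRing.Zmodule_isLmodule.Build R jordan
  jordan_scaleA jordan_scale1 jordan_scaleDr jordan_scaleDl.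

Definition jordan_circ X Y : jordan :=
  Sub (cay_scalemx 2^-1
         (cay_mulmx (val X) (val Y) + cay_mulmx (val Y) (val X)))
      (jordan_circ_subproof (valP X) (valP Y)).

(* The diagonal entries of a Hermitian matrix are real; [cay_re] only turns
   their sum into an element of R. *)
Definition jordan_tr X : R := cay_re (\tr (val X)).

Definition jordan_inner X Y : R := jordan_tr (jordan_circ X Y).

Definition jordan_id : jordan := Sub (cay_idmx R) (jordan_id_subproof R).

Definition jordan_cross X Y : jordan :=
  2^-1 *: (2 *: jordan_circ X Y - jordan_tr X *: Y - jordan_tr Y *: X
           + (jordan_tr X * jordan_tr Y - jordan_inner X Y) *: jordan_id).

Definition jordan_gamma X : jordan :=
  Sub (map_mx (@cay_gamma R) (val X)) (jordan_gamma_subproof (valP X)).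

Definition jordanC := complexification jordan.

HB.instance Definition _ := GRing.Lmodule.on jordanC.

Definition jordanC_inner : jordanC -> jordanC -> R[i] :=
  cplx_extform jordan_inner.

Definition jordanC_cross : jordanC -> jordanC -> jordanC :=
  cplx_ext2 jordan_cross.

Definition jordanC_det (X : jordanC) : R[i] :=
  3^-1 * jordanC_inner X (jordanC_cross X X).

Definition jordanC_tau : jordanC -> jordanC := @cplx_conj R jordan.

(* Semilinear in the first argument. *)
Definition jordanC_herm (X Y : jordanC) : R[i] :=
  jordanC_inner (jordanC_tau X) Y.

Definition jordanC_gamma : jordanC -> jordanC := cplx_ext jordan_gamma.

Definition e6P : {pred lin_aut jordanC} := fun alpha => `[<
  (forall X : jordanC, jordanC_det (alpha X) = jordanC_det X) /\
  (forall X Y : jordanC,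
     jordanC_herm (alpha X) (alpha Y) = jordanC_herm X Y) >].

Lemma e6_closed : group_closed e6P.
Proof.
split=> [|a b]; first by rewrite unfold_in; apply/asboolP.
rewrite !unfold_in => /asboolP[da ha] /asboolP[db hb]; apply/asboolP.
split=> [X|X Y].
  by rewrite da -[RHS](congr1 _ (lin_aut_VK b X)) db.
by rewrite ha -{2}(lin_aut_VK b X) -{2}(lin_aut_VK b Y) hb.
Qed.

Record E6 := MkE6 { e6_val : lin_aut jordanC; _ : e6_val \in e6P }.

HB.instance Definition _ := [isSub for e6_val].
HB.instance Definition _ := [Choice of E6 by <:].
HB.instance Definition _ :=
  SubChoice_isSubGroup.Build (lin_aut jordanC) e6P E6 e6_closed.

Lemma jordan_gammaD : {morph jordan_gamma : X Y / X + Y}.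
Proof.
by move=> X Y; apply/val_inj/matrixP => i j; rewrite !mxE cay_gammaD.
Qed.
Lemma jordan_gammaZ a : {morph jordan_gamma : X / a *: X}.
Proof. by move=> X; apply/val_inj/matrixP => i j; rewrite !mxE cay_gammaZ. Qed.
Lemma jordan_gammaN : {morph jordan_gamma : X / - X}.
Proof. by move=> X; rewrite -!scaleN1r jordan_gammaZ. Qed.
Lemma jordan_gammaK : involutive jordan_gamma.
Proof. by move=> X; apply/val_inj/matrixP => i j; rewrite !mxE cay_gammaK. Qed.
Lemma jordan_gamma_circ : {morph jordan_gamma : X Y / jordan_circ X Y}.
Proof.
move=> X Y; apply/val_inj/matrixP => i j.
rewrite !mxE cay_gammaZ cay_gammaD !(big_morph _ (@cay_gammaD R) (cay_gamma0 R)).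
by congr (_ *: (_ + _)); apply: eq_bigr => k _; rewrite !mxE cay_gammaM.
Qed.
Lemma jordan_gamma_tr X : jordan_tr (jordan_gamma X) = jordan_tr X.
Proof.
rewrite /jordan_tr /mxtrace !(big_morph (@cay_re R) (id1 := 0) (op1 := +%R)) //.
by apply: eq_bigr => i _; rewrite mxE.
Qed.
Lemma jordan_gamma_inner X Y :
  jordan_inner (jordan_gamma X) (jordan_gamma Y) = jordan_inner X Y.
Proof. by rewrite /jordan_inner -jordan_gamma_circ jordan_gamma_tr. Qed.
Lemma jordan_gamma_id : jordan_gamma jordan_id = jordan_id.
Proof.
apply/val_inj/matrixP => i j; rewrite !mxE.
by case: (_ == _); [congr Cay; rewrite /= oppr0 | exact: cay_gamma0].
Qed.
Lemma jordan_gamma_cross : {morph jordan_gamma : X Y / jordan_cross X Y}.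
Proof.
move=> X Y; rewrite /jordan_cross jordan_gamma_inner !jordan_gamma_tr.
rewrite jordan_gammaZ !jordan_gammaD !jordan_gammaN !jordan_gammaZ.
by rewrite jordan_gamma_circ jordan_gamma_id.
Qed.

Lemma jordanC_gamma_lin_aut : lin_autP jordanC_gamma.
Proof.
apply/asboolP; split.
  move=> a [X1 X2] [Y1 Y2]; congr Cplx => /=;
  by rewrite !(jordan_gammaD, jordan_gammaN, jordan_gammaZ).
by exists jordanC_gamma => -[X Y]; congr Cplx; rewrite /= jordan_gammaK.
Qed.

Definition gamma_lin_aut : lin_aut jordanC :=
  Sub jordanC_gamma jordanC_gamma_lin_aut.

Lemma jordanC_gamma_inner (X Y : jordanC) :
  jordanC_inner (jordanC_gamma X) (jordanC_gamma Y) = jordanC_inner X Y.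
Proof. by rewrite /jordanC_inner /cplx_extform /= !jordan_gamma_inner. Qed.

Lemma gamma_e6 : gamma_lin_aut \in e6P.
Proof.
rewrite unfold_in; apply/asboolP; split=> [X|X Y].
  rewrite /jordanC_det -[in RHS]jordanC_gamma_inner; congr (_ * jordanC_inner _ _).
  by congr Cplx; rewrite /= ?jordan_gammaD ?jordan_gammaN !jordan_gamma_cross.
rewrite /jordanC_herm -[in RHS]jordanC_gamma_inner.
by congr jordanC_inner; congr Cplx; rewrite /= jordan_gammaN.
Qed.

Definition gamma_E6 : E6 := Sub gamma_lin_aut gamma_e6.

Record E6gamma :=
  MkE6gamma { e6gamma_val : E6; _ : e6gamma_val \in centralizer gamma_E6 }.

HB.instance Definition _ := [isSub for e6gamma_val].
HB.instance Definition _ := [Choice of E6gamma by <:].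
HB.instance Definition _ := SubChoice_isSubGroup.Build E6
  (centralizer gamma_E6) E6gamma (centralizer_closed gamma_E6).

End ExceptionalJordanAlgebra.

(* Main.v *)
(* Replacing complexified quaternions by 2 x 2 complex matrices identifies the
   1-eigenspace of gamma with the skew-symmetric 6 x 6 complex matrices S and its
   (-1)-eigenspace with the 2 x 6 complex matrices a. In these coordinates
     det = Pf S - (a S a^T)_01,    <(S, a), (S', a')> = tr(S^* S')/2 + tr(a^* a'),
   so (p, A) in Sp(1) x SU(6) acts by S |-> A S A^T and a |-> p a A^*.
   Conversely, an element of the centralizer is a pair of linear maps (B, D) with
   ((D a)(B S)(D a)^T)_01 = (a S a^T)_01. As a has rank at most one exactly when
   (a S a^T)_01 = 0 for all skew S, and B is onto the skew matrices, D preserves the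
   matrices of rank at most one, hence D a = P a Q for some P and Q. Unitarity
   of D allows to rescale P into SU(2) = Sp(1) and Q into U(6); then B is
   S |-> A S A^T with A = Q^*, and invariance of the Pfaffian gives det A = 1. *)

From HB Require Import structures.
Require Import Defs.
From mathcomp Require Import all_boot all_order all_algebra.
From mathcomp Require Import perm boolp reals complex.
From mathcomp Require Import ring.

Set Implicit Arguments.
Unset Strict Implicit.
Unset Printing Implicit Defensive.

Import Order.TTheory GRing.Theory Num.Theory.
Local Open Scope ring_scope.
Local Open Scope quotient_scope.
Local Open Scope complex_scope.
Local Open Scope sesquilinear_scope.

(** * Linear maps preserving matrices of rank at most one *)

Section RankOne.
Variable F : fieldType.

(** Stated through 2 x 2 minors, the relation is symmetric but not transitive: the zero row is
    parallel to every row. *)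
Definition parallel m (x y : 'rV[F]_m) : Prop :=
  forall i j, x 0 i * y 0 j = x 0 j * y 0 i.

Lemma parallel_scale m (x y : 'rV[F]_m) l : x 0 l != 0 -> parallel x y ->
  y = (y 0 l / x 0 l) *: x.
Proof.
move=> xl xy; apply/rowP => j; rewrite mxE.
apply: (mulfI xl); rewrite (xy l j) [RHS]mulrCA [RHS]mulrA divfK //.
exact: mulrC.
Qed.

Lemma parallel_sub m (x y z : 'rV[F]_m) :
  parallel (x + y) z -> parallel y z -> parallel x z.
Proof.
move=> xyz yz i j; have := xyz i j; rewrite !mxE !mulrDl yz.
exact: addIr.
Qed.

Lemma parallel_factor n m (X : 'M[F]_(n, m)) (x : 'rV[F]_m) l : x 0 l != 0 ->
  (forall k, parallel x (row k X)) -> X = ((x 0 l)^-1 *: col l X) *m x.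
Proof.
move=> xl Xx; apply/row_matrixP => k; rewrite {1}(parallel_scale xl (Xx k)).
by apply/rowP => j; rewrite !mxE big_ord1 !mxE [(_ * X k l)]mulrC.
Qed.

Lemma parallelC m (x y : 'rV[F]_m) : parallel x y -> parallel y x.
Proof. by move=> xy i j; rewrite mulrC xy mulrC. Qed.

(** Pointwise dependence becomes global by subtracting from [Y] the multiple of [X] that makes one
    basis vector vanish: the difference [Z] maps into a line, and if [Z] is nonzero, [X] maps into
    the same line. *)
Lemma locally_dependent n m (X Y : 'M[F]_(n, m)) :
  (forall v, parallel (v *m X) (v *m Y)) ->
  (exists s t, ((s != 0) || (t != 0)) /\ s *: X + t *: Y = 0) \/
  (exists (c d : 'cV_n) (w : 'rV_m), X = c *m w /\ Y = d *m w).
Proof.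
move=> XY; have [X0|/matrix0Pn[k [l kl]]] := eqVneq X 0.
  by left; exists 1, 0; rewrite oner_eq0 X0 scaler0 scale0r addr0.
pose x := row k X; have xl : x 0 l != 0 by rewrite mxE.
have := XY (delta_mx 0 k); rewrite -!rowE -/x => /(parallel_scale xl) yE.
(* Z kills the k-th basis vector, so polarizing at that vector confines the image
   of Z to the line of x. *)
pose c := row k Y 0 l / x 0 l.
have [Z EZ] : exists Z, Z = Y - c *: X by eexists.
have Zk : row k Z = 0 by rewrite EZ linearB linearZ /= yE -/c subrr.
have XZ v : parallel (v *m X) (v *m Z).
  move=> i j; rewrite EZ mulmxBr -scalemxAr !mxE mulrBr mulrBr.
  have := XY v i j; rewrite !mxE => ->; ring.
have xZ v : parallel x (v *m Z).
  move=> i j; have := XZ (delta_mx 0 k + v) i j; have := XZ v i j.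
  rewrite !mulmxDl -!rowE Zk add0r -/x ![(x + _) 0 _]mxE !mulrDl => ->.
  exact: addIr.
have ZE : Z = ((x 0 l)^-1 *: col l Z) *m x.
  by apply: parallel_factor => // k'; rewrite rowE.
have [Z0|/matrix0Pn[k1 [l1 kl1]]] := eqVneq Z 0.
  by left; exists (- c), 1; rewrite oner_eq0 orbT scale1r scaleNr addrC -EZ.
right; have {l1 kl1} d1 : Z k1 l != 0.
  by apply: contraNneq kl1; rewrite {2}ZE !mxE big_ord1 !mxE => ->; rewrite mulr0 mul0r.
have Xx v : (v *m Z) 0 l != 0 -> parallel (v *m X) x.
  move=> vl; have := XZ v; rewrite (parallel_scale xl (xZ v)) => h i j.
  have e : (v *m Z) 0 l / x 0 l != 0 by rewrite mulf_neq0 ?invr_eq0.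
  by apply: (mulfI e); rewrite mulrCA [RHS]mulrCA; have := h i j;
    rewrite ![(_ *: x) 0 _]mxE.
have Xr k' : parallel x (row k' X).
  (* A basis vector killed by [Z] is replaced by its sum with the basis vector [k1], which [Z] does
     not kill; [Xx] applies to the sum and to [k1] itself. *)
  apply: parallelC; have [dk|dk] := eqVneq (Z k' l) 0; last first.
    by rewrite rowE; apply: Xx; rewrite -rowE mxE.
  apply: (@parallel_sub _ _ (row k1 X)); rewrite !rowE -?mulmxDl; apply: Xx.
    by rewrite mulmxDl -!rowE !mxE dk add0r.
  by rewrite -rowE mxE.
exists ((x 0 l)^-1 *: col l X), ((x 0 l)^-1 *: col l Z + c *: ((x 0 l)^-1 *: col l X)), x.
have XE := parallel_factor xl Xr; split=> //.
by rewrite mulmxDl -ZE -(scalemxAl c) -XE EZ subrK.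
Qed.

(** A common image line is excluded by dimension: [row_mx c d] has only two columns, so for [2 < n]
    some nonzero [v] would be killed by both maps. *)
Lemma locally_dependent_inj n m (X Y : 'M[F]_(n, m)) : (2 < n)%N ->
  (forall v, parallel (v *m X) (v *m Y)) ->
  (forall v : 'rV_n, v *m X = 0 -> v *m Y = 0 -> v = 0) ->
  exists x y (Q : 'M_(n, m)), ((x != 0) || (y != 0)) /\ (X = x *: Q /\ Y = y *: Q).
Proof.
move=> n2 /locally_dependent[[s [t [st e]]]|[c [d [w [-> ->]]]]] inj.
  have [s0|s0] := eqVneq s 0.
    exists 1, 0, X; rewrite oner_eq0 scale1r scale0r; split=> //; split=> //.
    move: st e; rewrite s0 eqxx scale0r add0r /= => t0 /eqP.
    by rewrite scaler_eq0 (negPf t0) => /eqP.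
  exists (- (t / s)), 1, Y; rewrite oner_eq0 orbT scale1r; split=> //; split=> //.
  apply: (scalerI s0); rewrite scalerA mulrN mulrCA divff // mulr1 scaleNr.
  by apply/eqP; rewrite -addr_eq0 e.
have : kermx (row_mx c d) != 0.
  rewrite -mxrank_eq0 mxrank_ker -lt0n subn_gt0.
  exact: leq_ltn_trans (rank_leq_col _) n2.
rewrite -nz_row_eq0 => /eqP[]; set v := nz_row _.
have : v *m row_mx c d = 0 by apply/sub_kermxP/nz_row_sub.
rewrite mul_mx_row -[0]row_mx0 => /eq_row_mx[vc vd].
by apply: inj; rewrite mulmxA ?vc ?vd mul0mx.
Qed.

(** For a matrix with two rows this is rank at most one. *)
Definition minors0 n (a : 'M[F]_(2, n)) : Prop := parallel (row 0 a) (row 1 a).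

Definition rows2 n (v w : 'rV[F]_n) : 'M[F]_(2, n) :=
  \matrix_(u, k) (if u == 0 then v 0 k else w 0 k).

Lemma row0_rows2 n (v w : 'rV[F]_n) : row 0 (rows2 v w) = v.
Proof. by apply/rowP => k; rewrite !mxE. Qed.

Lemma row1_rows2 n (v w : 'rV[F]_n) : row 1 (rows2 v w) = w.
Proof. by apply/rowP => k; rewrite !mxE. Qed.

Lemma matrix2P n (a b : 'M[F]_(2, n)) : row 0 a = row 0 b -> row 1 a = row 1 b -> a = b.
Proof.
move=> e0 e1; apply/row_matrixP => -[[|[|//]] h].
  by have -> : Ordinal h = 0 by apply: val_inj.
by have -> : Ordinal h = 1 by apply: val_inj.
Qed.

(** Matrices with one nonzero row have rank at most one, so by [locally_dependent_inj] each row of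
    the argument enters both rows of the image through a single matrix, [Q0] or [Q1], up to scalars.
    Matrices with two equal rows then make [Q0] and [Q1] proportional. *)
Lemma minors0_preserver n (D : {linear 'M[F]_(2, n) -> 'M[F]_(2, n)}) :
  (2 < n)%N -> injective D -> (forall a, minors0 a -> minors0 (D a)) ->
  exists (P : 'M_2) (Q : 'M_n), forall a, D a = P *m a *m Q.
Proof.
move=> n2 injD minD.
have D0 a : D a = 0 -> a = 0 by move=> e; apply: injD; rewrite e linear0.
have rows2_0 (v w : 'rV_n) : rows2 v w = 0 -> v = 0 /\ w = 0.
  by move=> e; split; [rewrite -(row0_rows2 v w)|rewrite -(row1_rows2 v w)];
    rewrite e linear0.
pose T (u r : 'I_2) : 'M_n := \matrix_(j, k) D (delta_mx u j) r k.
have DT a r : row r (D a) = row 0 a *m T 0 r + row 1 a *m T 1 r.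
  have DE k : D a r k = \sum_i \sum_j a i j * T i r j k.
    rewrite {1}(matrix_sum_delta a) linear_sum summxE; apply: eq_bigr => i _.
    by rewrite linear_sum summxE; apply: eq_bigr => j _; rewrite linearZ !mxE.
  apply/rowP => k; rewrite mxE DE big_ord_recl big_ord1 mxE.
  have -> : lift ord0 ord0 = 1 :> 'I_2 by apply: val_inj.
  by rewrite ![(_ *m _) _ _]mxE; congr (_ + _); apply: eq_bigr => j _; rewrite !mxE.
have minv0 (v : 'rV_n) : minors0 (rows2 v 0).
  by move=> i j; rewrite row0_rows2 row1_rows2 !mxE !mulr0.
have min0v (v : 'rV_n) : minors0 (rows2 0 v).
  by move=> i j; rewrite row0_rows2 row1_rows2 !mxE !mul0r.
have [x00 [x01 [Q0 [x0 [E00 E01]]]]] : exists x y (Q : 'M_n), ((x != 0) || (y != 0)) /\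
    (T 0 0 = x *: Q /\ T 0 1 = y *: Q).
  apply: locally_dependent_inj => // [v|v v0 v1].
    by have := minD _ (minv0 v);
      rewrite /minors0 !DT row0_rows2 row1_rows2 !mul0mx !addr0.
  suff /rows2_0[] : rows2 v 0 = 0 by [].
  by apply: D0; apply: matrix2P;
    rewrite DT row0_rows2 row1_rows2 ?v0 ?v1 mul0mx addr0 linear0.
have [x10 [x11 [Q1 [x1 [E10 E11]]]]] : exists x y (Q : 'M_n), ((x != 0) || (y != 0)) /\
    (T 1 0 = x *: Q /\ T 1 1 = y *: Q).
  apply: locally_dependent_inj => // [v|v v0 v1].
    by have := minD _ (min0v v);
      rewrite /minors0 !DT row0_rows2 row1_rows2 !mul0mx !add0r.
  suff /rows2_0[] : rows2 0 v = 0 by [].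
  by apply: D0; apply: matrix2P;
    rewrite DT row0_rows2 row1_rows2 ?v0 ?v1 mul0mx add0r linear0.
have row0D a : row 0 (D a) = x00 *: (row 0 a *m Q0) + x10 *: (row 1 a *m Q1).
  by rewrite DT E00 E10 -!scalemxAr.
have row1D a : row 1 (D a) = x01 *: (row 0 a *m Q0) + x11 *: (row 1 a *m Q1).
  by rewrite DT E01 E11 -!scalemxAr.
have DQ (v w : 'rV_n) : v *m Q0 = 0 -> w *m Q1 = 0 -> v = 0 /\ w = 0.
  move=> v0 w0; apply: rows2_0; apply: D0; apply: matrix2P.
    by rewrite row0D row0_rows2 row1_rows2 v0 w0 !scaler0 addr0 linear0.
  by rewrite row1D row0_rows2 row1_rows2 v0 w0 !scaler0 addr0 linear0.
have inj0 (v : 'rV_n) : v *m Q0 = 0 -> v = 0 by move=> /DQ/(_ (mul0mx _ _))[].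
have [d0|d0] := eqVneq (x00 * x11) (x01 * x10).
(* The two left factors are proportional, so the image of D is too small. *)
  have Q0u : Q0 \in unitmx by rewrite -row_free_unit; apply: inj_row_free.
  have [k [xk0 xk1]] : exists k, x10 = k * x00 /\ x11 = k * x01.
    have [z|z] := eqVneq x00 0.
      move: x0 d0; rewrite z eqxx mul0r /= => x01n /esym/eqP.
      rewrite mulf_eq0 (negPf x01n) => /eqP->.
      by exists (x11 / x01); rewrite mulr0 divfK.
    exists (x10 / x00); rewrite divfK //; split=> //.
    by apply: (mulfI z); rewrite d0 mulrA mulrCA divff // mulr1 mulrC.
  have n0 : (0 < n)%N by apply: leq_trans n2.
  pose w : 'rV[F]_n := delta_mx 0 (Ordinal n0).
  have : w != 0 by apply/matrix0Pn; exists 0, (Ordinal n0); rewrite !mxE !eqxx oner_eq0.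
  (* [v] cancels the contribution of [w] to the first row of the image and, by proportionality, to
     the second, so [D] kills [rows2 v w]. *)
  case/eqP; pose v := - k *: (w *m Q1 *m invmx Q0).
  have vE : v *m Q0 = - k *: (w *m Q1) by rewrite -scalemxAl mulmxKV.
  suff /rows2_0[] : rows2 v w = 0 by [].
  apply: D0; apply: matrix2P; rewrite ?row0D ?row1D row0_rows2 row1_rows2 vE linear0.
    by rewrite xk0 scalerA -scalerDl mulrN mulrC addNr scale0r.
  by rewrite xk1 scalerA -scalerDl mulrN mulrC addNr scale0r.
have [y0 [y1 [Q [yn [EQ0 EQ1]]]]] : exists x y (Q : 'M_n), ((x != 0) || (y != 0)) /\
    (Q0 = x *: Q /\ Q1 = y *: Q).
  apply: locally_dependent_inj => // [v|v v0 _]; last exact: inj0.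
  (* Each minor of the image of [rows2 v v] is the nonzero factor [x00 * x11 - x01 * x10] times the
     same minor of the rows [v *m Q0] and [v *m Q1]. *)
  have min2 : minors0 (rows2 v v).
    by move=> i j; rewrite row0_rows2 row1_rows2 mulrC.
  move=> i j; have := minD _ min2 i j.
  rewrite row0D row1D row0_rows2 row1_rows2.
  move: (v *m Q0) (v *m Q1) => p q; rewrite !mxE => e.
  have d1 : x00 * x11 - x01 * x10 != 0 by rewrite subr_eq0.
  apply: (mulfI d1); apply/eqP; rewrite -subr_eq0; apply/eqP.
  by move/eqP: e; rewrite -subr_eq0 => /eqP <-; ring.
exists (\matrix_(r, u) if r == 0 then if u == 0 then x00 * y0 else x10 * y1
  else if u == 0 then x01 * y0 else x11 * y1), Q => a.
apply: matrix2P; rewrite ?row0D ?row1D row_mul EQ0 EQ1 -!scalemxAr !scalerA;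
rewrite !scalemxAl -mulmxDl; congr (_ *m _).
  by apply/rowP => k; rewrite !mxE !big_ord_recl big_ord0 !mxE /= addr0;
    congr (_ + _ * a _ _); apply: val_inj.
by apply/rowP => k; rewrite !mxE !big_ord_recl big_ord0 !mxE /= addr0;
  congr (_ + _ * a _ _); apply: val_inj.
Qed.
End RankOne.

(** * The Pfaffian of a 6 x 6 matrix *)

Section Pfaffian.
Variable K : comNzRingType.

(** Permutations are sorted by their value at 0; injectivity of the parametrization suffices, since
    both sides have (n+1)! elements. *)
Lemma sum_lift_perm n (V : nmodType) (F : 'S_n.+1 -> V) :
  \sum_s F s = \sum_(j < n.+1) \sum_(s : 'S_n) F (lift_perm ord0 j s).
Proof.
rewrite pair_big (reindex (fun p => lift_perm ord0 p.1 p.2)) //=.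
apply: onW_bij; apply: inj_card_bij.
  move=> [j s] [j' s'] /= /permP e.
  have ej : j = j' by have := e ord0; rewrite !lift_perm_id.
  subst j'; congr pair; apply/permP => k.
  by have := e (lift ord0 k); rewrite !lift_perm_lift => /lift_inj.
by rewrite card_prod card_ord !card_Sn factS.
Qed.

(* [bump] in a form that reduces on constructors. *)
Fixpoint skip (j k : nat) : nat :=
  match j, k with
  | 0%N, _ => k.+1 | _.+1, 0%N => 0%N | j'.+1, k'.+1 => (skip j' k').+1
  end.

Lemma skipE j k : skip j k = bump j k.
Proof.
elim: j k => [|j IHj] [|k] //=.
by rewrite IHj bumpS.
Qed.

(* A signed sum over the permutations of {0, ..., n-1}, viewed as sequences of
   values; the recursion is on the first value, so that it can be computed. *)
Fixpoint altsum n (G : seq nat -> K) : K :=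
  if n is m.+1 then
    \sum_(j <- iota 0 n) (-1) ^+ j * altsum m (fun l => G (j :: map (skip j) l))
  else G [::].

Lemma altsumS n G : altsum n.+1 G =
  \sum_(j < n.+1) (-1) ^+ j * altsum n (fun l => G (val j :: map (skip j) l)).
Proof.
by rewrite -(big_mkord xpredT
  (fun j => (-1) ^+ j * altsum n (fun l => G (j :: map (skip j) l)))).
Qed.

(** Fixing the first value [j] splits off the sign [(-1) ^+ j] and renumbers the later values by
    [skip j]. *)
Lemma altsumE n G :
  \sum_(s : 'S_n) (-1) ^+ s * G [seq val (s i) | i <- enum 'I_n] = altsum n G.
Proof.
elim: n G => [|n IHn] G.
  rewrite (big_pred1 (1%g : 'S_0)) => [|s]; last by apply/esym/eqP/permP => -[].
  by rewrite odd_perm1 expr0 mul1r; congr G; apply: size0nil;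
    rewrite size_map size_enum_ord.
rewrite sum_lift_perm altsumS.
apply: eq_bigr => j _; rewrite -IHn big_distrr; apply: eq_bigr => s _ /=.
rewrite odd_lift_perm /= signr_addb signr_odd mulrA; congr (_ * G _).
rewrite enum_ordSl /= lift_perm_id -!map_comp; congr cons.
by apply: eq_map => i /=; rewrite lift_perm_lift /= skipE.
Qed.

(** Each of the three perfect matchings of four indices comes from 8 permutations with equal signed
    terms. The parameters [c] and [f] absorb the factor of the first two values and the renumbering
    they cause. *)
Lemma altsum4E (c : K) (t : nat -> nat -> K) (f : nat -> nat) (G : seq nat -> K) :
  (forall i j, t i j = - t j i) ->
  (forall i j k l, G [:: i; j; k; l] = c * (t (f i) (f j) * t (f k) (f l))) ->
  altsum 4 G = 8%:R * c * (t (f 0) (f 1) * t (f 2) (f 3) - t (f 0) (f 2) * t (f 1) (f 3)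
    + t (f 0) (f 3) * t (f 1) (f 2)).
Proof.
move=> tC GE; rewrite /altsum /= !big_cons !big_nil /= !GE.
rewrite (tC (f 1) (f 0)) (tC (f 2) (f 0)) (tC (f 3) (f 0)) (tC (f 2) (f 1))
  (tC (f 3) (f 1)) (tC (f 3) (f 2)).
ring.
Qed.

(** The Pfaffian of size 6, expanded along the first row. *)
Definition pf_entries (s : nat -> nat -> K) : K :=
  s 0 1 * (s 2 3 * s 4 5 - s 2 4 * s 3 5 + s 2 5 * s 3 4)
- s 0 2 * (s 1 3 * s 4 5 - s 1 4 * s 3 5 + s 1 5 * s 3 4)
+ s 0 3 * (s 1 2 * s 4 5 - s 1 4 * s 2 5 + s 1 5 * s 2 4)
- s 0 4 * (s 1 2 * s 3 5 - s 1 3 * s 2 5 + s 1 5 * s 2 3)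
+ s 0 5 * (s 1 2 * s 3 4 - s 1 3 * s 2 4 + s 1 4 * s 2 3).

(** Splitting off the first two values leaves 30 instances of [altsum4E] instead of 720 terms. *)
Lemma altsum6E (t : nat -> nat -> K) : (forall i j, t i j = - t j i) ->
  altsum 6 (fun l => t (nth 0 l 0) (nth 0 l 1) *
    (t (nth 0 l 2) (nth 0 l 3) * t (nth 0 l 4) (nth 0 l 5))) = 48%:R * pf_entries t.
Proof.
move=> tC; set G := (fun l : seq nat => _).
have H i j : altsum 4 (fun l => G (i :: map (skip i) (j :: map (skip j) l))) =
    let f k := skip i (skip j k) in
    8%:R * t i (skip i j) * (t (f 0) (f 1) * t (f 2) (f 3)
    - t (f 0) (f 2) * t (f 1) (f 3) + t (f 0) (f 3) * t (f 1) (f 2)).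
  exact: altsum4E.
have H5 (F : seq nat -> K) : altsum 5 F =
   altsum 4 (fun l => F (0%N :: map (skip 0) l))
   - altsum 4 (fun l => F (1%N :: map (skip 1) l))
   + altsum 4 (fun l => F (2%N :: map (skip 2) l))
   - altsum 4 (fun l => F (3%N :: map (skip 3) l))
   + altsum 4 (fun l => F (4%N :: map (skip 4) l)).
  rewrite -[LHS]/(\sum_(j <- [:: 0%N; 1%N; 2%N; 3%N; 4%N]) (-1) ^+ j *
    altsum 4 (fun l => F (j :: map (skip j) l))) !big_cons big_nil.
  ring.
rewrite -[LHS]/(\sum_(j <- [:: 0%N; 1%N; 2%N; 3%N; 4%N; 5%N]) (-1) ^+ j *
    altsum 5 (fun l => G (j :: map (skip j) l))) !big_cons big_nil !H5 !H /=.
rewrite (tC 1 0) (tC 2 0) (tC 3 0) (tC 4 0) (tC 5 0) (tC 2 1) (tC 3 1) (tC 4 1) (tC 5 1)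
 (tC 3 2) (tC 4 2) (tC 5 2) (tC 4 3) (tC 5 3) (tC 5 4) /pf_entries.
ring.
Qed.

(* For skew-symmetric matrices this is 48 = 2^3 * 3! times the Pfaffian. *)
Definition pfsum (S : 'M[K]_6) : K := \sum_(s : 'S_6) (-1) ^+ s *
  (S (s (inord 0)) (s (inord 1)) * S (s (inord 2)) (s (inord 3)) *
   S (s (inord 4)) (s (inord 5))).

Lemma pfsum_cong (A S : 'M[K]_6) : pfsum (A *m S *m A^T) = \det A * pfsum S.
Proof.
(* Both sides expand as sums over functions f; the dependence on A is only through
   a determinant, so multiplicativity of [\det] reduces the identity to A = 1. *)
pose g (f : {ffun 'I_3 -> 'I_6 * 'I_6}) (j : 'I_6) : 'I_6 :=
  if odd j then (f (inord j./2)).2 else (f (inord j./2)).1.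
pose h (f : {ffun 'I_3 -> 'I_6 * 'I_6}) : K := \prod_t S (f t).1 (f t).2.
suff expand B : pfsum (B *m S *m B^T) =
    \sum_f \det (rowsub (g f) B^T) * h f.
  have := expand 1%:M; rewrite trmx1 mul1mx mulmx1 expand => ->.
  rewrite big_distrr; apply: eq_bigr => f _ /=.
  by rewrite -[B in rowsub _ B^T]mulmx1 trmx_mul trmx1 -mul_rowsub_mx det_mulmx det_tr
    mulrCA mulrA.
have congE i j : (B *m S *m B^T) i j = \sum_p B i p.1 * S p.1 p.2 * B j p.2.
  rewrite !mxE -(pair_bigA _ (fun k l => B i k * S k l * B j l)) exchange_big /=.
  by apply: eq_bigr => l _; rewrite !mxE big_distrl.
have sum3p (F : 'I_3 -> K) : \prod_i F i = F (inord 0) * F (inord 1) * F (inord 2).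
  rewrite !big_ord_recl big_ord0 mulr1 mulrA.
  by congr (_ * _ * _); congr F; apply: val_inj; rewrite /= inordK.
(* In the product of three double sums, [f] picks one index pair for each factor, and [g f] lists
   the six picked indices in order. *)
pose F (s : {perm 'I_6}) (t : 'I_3) (p : 'I_6 * 'I_6) :=
  B (s (inord t.*2)) p.1 * S p.1 p.2 * B (s (inord t.*2.+1)) p.2.
have distr (s : {perm 'I_6}) : (B *m S *m B^T) (s (inord 0)) (s (inord 1)) *
    (B *m S *m B^T) (s (inord 2)) (s (inord 3)) *
    (B *m S *m B^T) (s (inord 4)) (s (inord 5)) =
    \sum_(f : {ffun 'I_3 -> 'I_6 * 'I_6}) \prod_t F s t (f t).
  by rewrite -(bigA_distr_bigA (F s)) sum3p !congE /F !inordK.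
rewrite /pfsum; under eq_bigr => s _ do rewrite distr big_distrr.
rewrite exchange_big; apply: eq_bigr => f _ /=.
rewrite big_distrl; apply: eq_bigr => s _ /=.
rewrite -mulrA; congr (_ * _).
rewrite [X in _ = X * _](eq_bigr (fun i => B (s i) (g f i))); last first.
  by move=> i _; rewrite !mxE.
rewrite /F !sum3p !inordK //.
have -> (E : 'I_6 -> K) : \prod_i E i = E (inord 0) * E (inord 1) * E (inord 2) *
    E (inord 3) * E (inord 4) * E (inord 5).
  rewrite !big_ord_recl big_ord0 mulr1 !mulrA.
  by congr (_ * _ * _ * _ * _ * _); congr E; apply: val_inj; rewrite /= inordK.
by rewrite /h sum3p /g !inordK //=; ring.
Qed.
End Pfaffian.

(** * The forms of the exceptional Jordan algebra in matrix coordinates *)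

Section RealForms.
Variable R : realType.
Implicit Types X Y Z : jordan R.

Definition jordan_diag X (i : 'I_3) : R := quat0 (cay1 (val X i i)).

Lemma jordan_valC X i j : val X j i = cay_conj (val X i j).
Proof. by have /eqP {1}<- := valP X; rewrite !mxE. Qed.

Lemma jordan_val_diag X i : val X i i = Cay (Quat (jordan_diag X i) 0 0 0) 0.
Proof.
have := jordan_valC X i i; rewrite /jordan_diag.
case: (val X i i) => -[m0 m1 m2 m3] [a0 a1 a2 a3] /= [] e1 e2 e3 e4 e5 e6 e7.
have h (x : R) : x = - x -> x = 0.
  by move=> xN; apply/eqP; rewrite -eqNr -xN.
by rewrite !(h _ e1, h _ e2, h _ e3, h _ e4, h _ e5, h _ e6, h _ e7).
Qed.

(** The Euclidean inner product in the eight real coordinates. *)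
Definition cay_dot (x y : cayley R) : R := cay_re (cay_mul x (cay_conj y)).

Lemma sum3 (V : nmodType) (F : 'I_3 -> V) : \sum_i F i = F 0 + F 1 + F 2%:R.
Proof.
rewrite !big_ord_recl big_ord0 addr0 addrA.
congr (_ + F _ + F _); exact: val_inj.
Qed.

Lemma cay_reD : {morph @cay_re R : x y / x + y}.
Proof. by []. Qed.

Lemma jordan_trE X : jordan_tr X = jordan_diag X 0 + jordan_diag X 1 + jordan_diag X 2%:R.
Proof. by rewrite /jordan_tr /mxtrace sum3. Qed.

(** A Hermitian matrix is given by its diagonal and its entries (0, 1), (1, 2), (2, 0); the opposite
    entries are their conjugates, whence the factor 2. *)
Lemma jordan_innerE X Y : jordan_inner X Y =
  jordan_diag X 0 * jordan_diag Y 0 + jordan_diag X 1 * jordan_diag Y 1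
    + jordan_diag X 2%:R * jordan_diag Y 2%:R +
  2 * (cay_dot (val X 0 1) (val Y 0 1) + cay_dot (val X 1 2%:R) (val Y 1 2%:R)
     + cay_dot (val X 2%:R 0) (val Y 2%:R 0)).
Proof.
rewrite /jordan_inner jordan_trE /jordan_diag /= !mxE !sum3.
rewrite !jordan_val_diag.
rewrite (jordan_valC X 0 1) (jordan_valC X 1 2%:R)  (jordan_valC X 2%:R 0).
rewrite (jordan_valC Y 0 1) (jordan_valC Y 1 2%:R)  (jordan_valC Y 2%:R 0).
rewrite /cay_dot /cay_re.
case: (val X 0 1) => [[????] [????]].
case: (val X 1 2%:R) => [[????] [????]].
case: (val X 2%:R 0) => [[????] [????]].
case: (val Y 0 1) => [[????] [????]].
case: (val Y 1 2%:R) => [[????] [????]].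
case: (val Y 2%:R 0) => [[????] [????]] /=.
by field.
Qed.

Definition cay_tri (x y z : cayley R) : R := cay_re (cay_mul x (cay_mul y z)).
Definition diag_prod X Y Z := jordan_diag X 0 * jordan_diag Y 1 * jordan_diag Z 2%:R.
Definition diag_dot X i (x y : cayley R) := jordan_diag X i * cay_dot x y.

(** This is three times the symmetric trilinear polarization of the cubic form d0 d1 d2 - d0 |x12|^2
    - d1 |x20|^2 - d2 |x01|^2 + 2 Re(x01 (x12 x20)). *)
Lemma jordan_crossE X Y Z : jordan_inner X (jordan_cross Y Z) =
  2^-1 * (diag_prod X Y Z + diag_prod X Z Y + diag_prod Y X Z + diag_prod Y Z X
    + diag_prod Z X Y + diag_prod Z Y X)
  - (diag_dot X 0 (val Y 1 2%:R) (val Z 1 2%:R)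
   + diag_dot Y 0 (val X 1 2%:R) (val Z 1 2%:R)
   + diag_dot Z 0 (val X 1 2%:R) (val Y 1 2%:R))
  - (diag_dot X 1 (val Y 2%:R 0) (val Z 2%:R 0)
   + diag_dot Y 1 (val X 2%:R 0) (val Z 2%:R 0)
   + diag_dot Z 1 (val X 2%:R 0) (val Y 2%:R 0))
  - (diag_dot X 2%:R (val Y 0 1) (val Z 0 1)
   + diag_dot Y 2%:R (val X 0 1) (val Z 0 1)
   + diag_dot Z 2%:R (val X 0 1) (val Y 0 1))
  + (cay_tri (val X 0 1) (val Y 1 2%:R) (val Z 2%:R 0)
   + cay_tri (val X 0 1) (val Z 1 2%:R) (val Y 2%:R 0)
   + cay_tri (val Y 0 1) (val X 1 2%:R) (val Z 2%:R 0)
   + cay_tri (val Y 0 1) (val Z 1 2%:R) (val X 2%:R 0)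
   + cay_tri (val Z 0 1) (val X 1 2%:R) (val Y 2%:R 0)
   + cay_tri (val Z 0 1) (val Y 1 2%:R) (val X 2%:R 0)).
Proof.
rewrite (jordan_innerE X) /jordan_cross /= /jordan_diag !mxE /=.
rewrite jordan_innerE !jordan_trE !sum3.
rewrite !jordan_val_diag /diag_prod /diag_dot.
rewrite (jordan_valC Y 0 1) (jordan_valC Y 1 2%:R)  (jordan_valC Y 2%:R 0).
rewrite (jordan_valC Z 0 1) (jordan_valC Z 1 2%:R)  (jordan_valC Z 2%:R 0).
rewrite /cay_tri /cay_dot /cay_re.
move: (jordan_diag X 0) (jordan_diag X 1) (jordan_diag X 2%:R) (jordan_diag Y 0)
  (jordan_diag Y 1) (jordan_diag Y 2%:R)
  (jordan_diag Z 0) (jordan_diag Z 1) (jordan_diag Z 2%:R).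
case: (val X 0 1) => [[????] [????]].
case: (val X 1 2%:R) => [[????] [????]].
case: (val X 2%:R 0) => [[????] [????]].
case: (val Y 0 1) => [[????] [????]].
case: (val Y 1 2%:R) => [[????] [????]].
case: (val Y 2%:R 0) => [[????] [????]].
case: (val Z 0 1) => [[????] [????]].
case: (val Z 1 2%:R) => [[????] [????]].
case: (val Z 2%:R 0) => [[????] [????]] /= *.
by field.
Qed.
End RealForms.

(** * Matrix coordinates and the determinant *)

Section Coordinates.
Variable R : realType.
Notation C := R[i].

Lemma cay_mulDr (x y z : cayley R) :
  cay_mul x (y + z) = cay_mul x y + cay_mul x z.
Proof.
case: x y z => [? ?] [? ?] [? ?]; congr Cay => /=.
  by rewrite quat_conjD mulrDr mulrDl opprD addrACA.
by rewrite quat_conjD mulrDr mulrDl addrACA.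
Qed.

Lemma cay_mulNr (x y : cayley R) : cay_mul x (- y) = - cay_mul x y.
Proof.
case: x y => [? ?] [? ?]; congr Cay => /=.
  by rewrite quat_conjN mulrN mulNr opprD.
by rewrite quat_conjN mulrN mulNr opprD.
Qed.

Lemma cay_reN (x : cayley R) : cay_re (- x) = - cay_re x.
Proof. by []. Qed.

Implicit Types (X Y Z : jordanC R) (q r : quat R).

Lemma conjCE (z : C) : z^*%R = conjc z.
Proof. by []. Qed.

(* The entries of the image of q + ir under the isomorphism of the complexified
   quaternions with the 2 x 2 complex matrices that sends e1 to diag(i, -i) and
   e2 to [[0, 1], [-1, 0]]. *)
Definition quatC_entry (q r : quat R) (u v : nat) : C :=
  match u, v with
  | 0%N, 0%N => (quat0 q - quat1 r) +i* (quat0 r + quat1 q)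
  | 0%N, 1%N => (quat2 q - quat3 r) +i* (quat2 r + quat3 q)
  | 1%N, 0%N => (- quat2 q - quat3 r) +i* (- quat2 r + quat3 q)
  | 1%N, 1%N => (quat0 q + quat1 r) +i* (quat0 r - quat1 q)
  | _, _ => 0
  end.

Definition quat_entry X i j u v : C :=
  quatC_entry (cay1 (val (cplx_re X) i j)) (cay1 (val (cplx_im X) i j)) u v.
Definition e4_entry X i j u v : C :=
  quatC_entry (cay2 (val (cplx_re X) i j)) (cay2 (val (cplx_im X) i j)) u v.
Definition diag_entry X i : C := jordan_diag (cplx_re X) i +i* jordan_diag (cplx_im X) i.

(* The entries above the diagonal of k(M) J, where M is the quaternionic part of X,
   k(M) is obtained by replacing each entry of M with its 2 x 2 complex matrix, and
   J is block diagonal with blocks [[0, 1], [-1, 0]]; the block (0, 2) comes from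
   the conjugate of the entry (2, 0) of M, whence the adjugate. *)
Definition skew_entry X (i j : nat) : C :=
  match i, j with
  | 0%N, 1%N => diag_entry X 0 | 2%N, 3%N => diag_entry X 1
  | 4%N, 5%N => diag_entry X 2%:R
  | 0%N, 2%N => - quat_entry X 0 1 0 1 | 0%N, 3%N => quat_entry X 0 1 0 0
  | 1%N, 2%N => - quat_entry X 0 1 1 1 | 1%N, 3%N => quat_entry X 0 1 1 0
  | 2%N, 4%N => - quat_entry X 1 2%:R 0 1 | 2%N, 5%N => quat_entry X 1 2%:R 0 0
  | 3%N, 4%N => - quat_entry X 1 2%:R 1 1 | 3%N, 5%N => quat_entry X 1 2%:R 1 0
  | 0%N, 4%N => quat_entry X 2%:R 0 0 1 | 0%N, 5%N => quat_entry X 2%:R 0 1 1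
  | 1%N, 4%N => - quat_entry X 2%:R 0 0 0 | 1%N, 5%N => - quat_entry X 2%:R 0 1 0
  | _, _ => 0
  end.

Definition skew_of (s : nat -> nat -> C) : 'M[C]_6 :=
  \matrix_(i, j) (if (i < j)%N then s i j else if (j < i)%N then - s j i else 0).

(* The 2 x 6 matrix of blocks k(a1), k(a2), k(a3), where xi = mi + ai e4 and x1, x2,
   x3 are the entries (1, 2), (2, 0), (0, 1) of X. *)
Definition rect_entry X (u j : nat) : C :=
  match j with
  | 0%N => e4_entry X 1 2%:R u 0 | 1%N => e4_entry X 1 2%:R u 1
  | 2%N => e4_entry X 2%:R 0 u 0 | 3%N => e4_entry X 2%:R 0 u 1
  | 4%N => e4_entry X 0 1 u 0 | 5%N => e4_entry X 0 1 u 1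
  | _ => 0
  end.

Definition skew_part X : 'M[C]_6 := skew_of (skew_entry X).
Definition rect_part X : 'M[C]_(2, 6) := \matrix_(u, j) rect_entry X u j.

Definition ent (S : 'M[C]_6) (i j : nat) : C := S (inord i) (inord j).
Definition pf6 (S : 'M[C]_6) : C := pf_entries (ent S).

Lemma sum6 (V : nmodType) (F : 'I_6 -> V) : \sum_i F i =
  F (inord 0) + F (inord 1) + F (inord 2) + F (inord 3) + F (inord 4) + F (inord 5).
Proof.
rewrite !big_ord_recl big_ord0 addr0 !addrA.
by do 5?[congr (_ + _)]; congr F; apply: val_inj; rewrite /= inordK.
Qed.

Lemma jordan_innerDr (A B D : jordan R) :
  jordan_inner A (B + D) = jordan_inner A B + jordan_inner A D.
Proof.
rewrite !jordan_innerE /jordan_diag !mxE /cay_dot /=.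
by rewrite !cay_conjD !cay_mulDr !cay_reD; ring.
Qed.

Lemma jordan_innerNr (A B : jordan R) :
  jordan_inner A (- B) = - jordan_inner A B.
Proof.
rewrite !jordan_innerE /jordan_diag !mxE /cay_dot /=.
by rewrite !cay_conjN !cay_mulNr !cay_reN; ring.
Qed.

Lemma ReD (x y : C) : complex.Re (x + y) = complex.Re x + complex.Re y.
Proof. by case: x y => ? ? [? ?]. Qed.

Lemma ImD (x y : C) : complex.Im (x + y) = complex.Im x + complex.Im y.
Proof. by case: x y => ? ? [? ?]. Qed.

Lemma ReN (x : C) : complex.Re (- x) = - complex.Re x.
Proof. by case: x. Qed.

Lemma ImN (x : C) : complex.Im (- x) = - complex.Im x.
Proof. by case: x. Qed.

Lemma ReM (x y : C) : complex.Re (x * y) =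
  complex.Re x * complex.Re y - complex.Im x * complex.Im y.
Proof. by case: x y => ? ? [? ?]. Qed.

Lemma ImM (x y : C) : complex.Im (x * y) =
  complex.Re x * complex.Im y + complex.Im x * complex.Re y.
Proof. by case: x y => ? ? [? ?]. Qed.

Definition reimE := (ReD, ImD, ReN, ImN, ReM, ImM).

Lemma complex2E : (2 : C) = 2 +i* 0.
Proof. by rewrite -(rmorph_nat (real_complex R)). Qed.

(* In [dotC] and [triC] a pair x, x' stands for the complex element x + ix'. *)
Definition dotC (x x' : cayley R) : C :=
  (cay_dot x x - cay_dot x' x') +i* (2 * cay_dot x x').

Definition triC (x x' y y' z z' : cayley R) : C :=
  (cay_tri x y z - cay_tri x y' z' - cay_tri x' y z' - cay_tri x' y' z) +i*
  (cay_tri x y z' + cay_tri x y' z + cay_tri x' y z - cay_tri x' y' z').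

Lemma cay_dotC (x y : cayley R) : cay_dot x y = cay_dot y x.
Proof.
by case: x y => [[????] [????]] [[????] [????]]; rewrite /cay_dot /cay_re /=; ring.
Qed.

Lemma complex_eq (x y : C) : complex.Re x = complex.Re y ->
  complex.Im x = complex.Im y -> x = y.
Proof. by case: x y => ? ? [? ?] /= -> ->. Qed.

(** The complex form is expanded into values of the real trilinear form of [jordan_crossE] at the
    real and imaginary parts of [X]. *)
Lemma jordanC_det_polyE X : let x i j := val (cplx_re X) i j in
  let y i j := val (cplx_im X) i j in
  jordanC_det X = diag_entry X 0 * diag_entry X 1 * diag_entry X 2%:R
   - diag_entry X 0 * dotC (x 1 2%:R) (y 1 2%:R)
   - diag_entry X 1 * dotC (x 2%:R 0) (y 2%:R 0)
   - diag_entry X 2%:R * dotC (x 0 1) (y 0 1)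
   + 2 * triC (x 0 1) (y 0 1) (x 1 2%:R) (y 1 2%:R) (x 2%:R 0) (y 2%:R 0).
Proof.
rewrite /jordanC_det /=; apply: (mulfI (_ : 3%:R != 0)); first by rewrite pnatr_eq0.
rewrite mulrA divff ?pnatr_eq0 // mul1r.
case: X => X Y; rewrite /jordanC_inner /cplx_extform /=.
rewrite !(jordan_innerDr, jordan_innerNr, jordan_crossE) /diag_prod /diag_dot /triC /dotC.
rewrite (cay_dotC (val Y 0 1) (val X 0 1)) (cay_dotC (val Y 1 2%:R) (val X 1 2%:R)).
rewrite (cay_dotC (val Y 2%:R 0) (val X 2%:R 0)) /diag_entry /=.
by apply: complex_eq; rewrite /= ?reimE /= ?reimE; field.
Qed.

(** The norm of a complexified quaternion is the determinant of its 2 x 2 matrix, and the Cayley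
    norm is the sum of two such norms. *)
Lemma dotCE x y :
  let k := quatC_entry (cay1 x) (cay1 y) in
  let h := quatC_entry (cay2 x) (cay2 y) in
  dotC x y = (k 0 0 * k 1 1 - k 0 1 * k 1 0) + (h 0 0 * h 1 1 - h 0 1 * h 1 0).
Proof.
case: x y => [[????] [????]] [[????] [????]] /=; rewrite /dotC /cay_dot /cay_re /=.
by apply: complex_eq; rewrite !reimE /=; ring.
Qed.

(** The trace of the matrix product [k l m], written out for 2 x 2 matrices. *)
Definition tr_mul3 (K : nzRingType) (k l m : nat -> nat -> K) : K :=
  k 0 0 * (l 0 0 * m 0 0 + l 0 1 * m 1 0) + k 0 1 * (l 1 0 * m 0 0 + l 1 1 * m 1 0)
+ k 1 0 * (l 0 0 * m 0 1 + l 0 1 * m 1 1) + k 1 1 * (l 1 0 * m 0 1 + l 1 1 * m 1 1).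

Lemma Re_tr_mul3 (k l m : nat -> nat -> C) :
  let re k u v := complex.Re (k u v) in let im k u v := complex.Im (k u v) in
  complex.Re (tr_mul3 k l m) = tr_mul3 (re k) (re l) (re m) - tr_mul3 (re k) (im l) (im m)
    - tr_mul3 (im k) (re l) (im m) - tr_mul3 (im k) (im l) (re m).
Proof. by rewrite /tr_mul3 !reimE; ring. Qed.

Lemma Im_tr_mul3 (k l m : nat -> nat -> C) :
  let re k u v := complex.Re (k u v) in let im k u v := complex.Im (k u v) in
  complex.Im (tr_mul3 k l m) = tr_mul3 (re k) (re l) (im m) + tr_mul3 (re k) (im l) (re m)
    + tr_mul3 (im k) (re l) (re m) - tr_mul3 (im k) (im l) (im m).
Proof. by rewrite /tr_mul3 !reimE; ring. Qed.

(** The adjugate, which is the matrix counterpart of quaternion conjugation. *)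
Definition adj2 (k : nat -> nat -> C) (u v : nat) : C :=
  match u, v with
  | 0%N, 0%N => k 1 1 | 0%N, 1%N => - k 0 1 | 1%N, 0%N => - k 1 0 | 1%N, 1%N => k 0 0
  | _, _ => 0
  end.

(** Twice the real part of a quaternion is the trace of its matrix; the four terms are those of the
    quaternionic part of x(yz), rotated cyclically under the trace. *)
Lemma triCE x x' y y' z z' :
  let k x x' := quatC_entry (cay1 x) (cay1 x') in
  let h x x' := quatC_entry (cay2 x) (cay2 x') in
  2 * triC x x' y y' z z' =
  tr_mul3 (k x x') (k y y') (k z z') - tr_mul3 (adj2 (h y y')) (h x x') (k z z')
  - tr_mul3 (adj2 (h z z')) (h x x') (adj2 (k y y'))
  - tr_mul3 (adj2 (h z z')) (h y y') (k x x').
Proof.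
case: x x' => [[????] [????]] [[????] [????]].
case: y y' => [[????] [????]] [[????] [????]].
case: z z' => [[????] [????]] [[????] [????]] /=.
rewrite /triC /cay_tri /cay_re complex2E /=.
apply: complex_eq;
  rewrite ?(ReD, ReN, ImD, ImN, Re_tr_mul3, Im_tr_mul3) ?ReM ?ImM;
  by rewrite /tr_mul3 /= ?ReN ?ImN /=; ring.
Qed.

(** The terms without [e4] components make up the Pfaffian; those quadratic in them make up the
    alternating form. *)
Lemma jordanC_detE X :
  jordanC_det X = pf6 (skew_part X) - (rect_part X *m skew_part X *m (rect_part X)^T) 0 1.
Proof.
rewrite mxE sum6 !mxE !sum6 /pf6 /pf_entries /ent !mxE !inordK //=.
rewrite jordanC_det_polyE /= triCE !dotCE /rect_entry /e4_entry /quat_entry /tr_mul3 /=.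
ring.
Qed.
End Coordinates.

(** * The inverse coordinate map, linearity, and the action of gamma *)

Section InverseCoordinates.
Variable R : realType.
Notation C := R[i].
Implicit Types (X Y Z : jordanC R) (q r : quat R).

Lemma ord3_ind (P : 'I_3 -> Prop) : P 0 -> P 1 -> P 2%:R -> forall i, P i.
Proof.
by move=> P0 P1 P2 [[|[|[|//]]] h]; [move: P0|move: P1|move: P2]; congr P; apply: val_inj.
Qed.

Lemma jordan_eqP (A B : jordan R) : jordan_diag A 0 = jordan_diag B 0 ->
  jordan_diag A 1 = jordan_diag B 1 ->
  jordan_diag A 2%:R = jordan_diag B 2%:R -> val A 0 1 = val B 0 1 ->
  val A 1 2%:R = val B 1 2%:R -> val A 2%:R 0 = val B 2%:R 0 -> A = B.
Proof.
move=> d0 d1 d2 e01 e12 e20; apply/val_inj/matrixP.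
elim/ord3_ind; elim/ord3_ind => //; rewrite ?jordan_val_diag ?d0 ?d1 ?d2 //.
- by rewrite jordan_valC e20 -jordan_valC.
- by rewrite jordan_valC e01 -jordan_valC.
- by rewrite jordan_valC e12 -jordan_valC.
Qed.

Section Make.
Variables (d0 d1 d2 : R) (x y z : cayley R).
(** The default branch is reached at position (0, 2) only. *)
Definition jordan_mk_mx : 'M[cayley R]_3 := \matrix_(i, j)
  match nat_of_ord i, nat_of_ord j with
  | 0%N, 0%N => Cay (Quat d0 0 0 0) 0
  | 1%N, 1%N => Cay (Quat d1 0 0 0) 0
  | 2%N, 2%N => Cay (Quat d2 0 0 0) 0
  | 0%N, 1%N => x | 1%N, 0%N => cay_conj x
  | 1%N, 2%N => y | 2%N, 1%N => cay_conj y
  | 2%N, 0%N => z | _, _ => cay_conj z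
  end.

Lemma cay_conjK : involutive (@cay_conj R).
Proof. by case=> m a; rewrite /cay_conj /= quat_conjK opprK. Qed.

Lemma cay_conj_real (d : R) : cay_conj (Cay (Quat d 0 0 0) 0) = Cay (Quat d 0 0 0) 0.
Proof. by rewrite /cay_conj /quat_conj /= !oppr0. Qed.

Lemma jordan_mk_subproof : jordan_mk_mx \in @jordanP R.
Proof.
rewrite unfold_in; apply/eqP/matrixP.
by elim/ord3_ind; elim/ord3_ind; rewrite !mxE /= ?cay_conjK ?cay_conj_real.
Qed.

Definition jordan_mk : jordan R := Sub jordan_mk_mx jordan_mk_subproof.

Lemma jordan_mkE :
  (jordan_diag jordan_mk 0 = d0) * (jordan_diag jordan_mk 1 = d1) *
  (jordan_diag jordan_mk 2%:R = d2) *
  (val jordan_mk 0 1 = x) * (val jordan_mk 1 2%:R = y) * (val jordan_mk 2%:R 0 = z).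
Proof. by rewrite /jordan_diag /= !mxE. Qed.
End Make.

(** [qre] and [qim] solve the equations of [quatC_entry] for q and r. *)
Definition qre (k00 k01 k10 k11 : C) : quat R :=
  Quat ((complex.Re k00 + complex.Re k11) / 2) ((complex.Im k00 - complex.Im k11) / 2)
    ((complex.Re k01 - complex.Re k10) / 2) ((complex.Im k01 + complex.Im k10) / 2).
Definition qim (k00 k01 k10 k11 : C) : quat R :=
  Quat ((complex.Im k00 + complex.Im k11) / 2) ((complex.Re k11 - complex.Re k00) / 2)
    ((complex.Im k01 - complex.Im k10) / 2) (- (complex.Re k01 + complex.Re k10) / 2).

Lemma quatC_entryE k00 k01 k10 k11 :
  let k := quatC_entry (qre k00 k01 k10 k11) (qim k00 k01 k10 k11) in
  (k 0 0 = k00) * (k 0 1 = k01) * (k 1 0 = k10) * (k 1 1 = k11).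
Proof. by split; [split; [split|]|]; apply: complex_eq => /=; field. Qed.

Definition ent26 (a : 'M[C]_(2,6)) (i j : nat) : C := a (inord i) (inord j).

(** Only the entries of [S] above the diagonal are read, so this inverts the coordinates on
    skew-symmetric [S]. *)
Definition jordanC_of (S : 'M[C]_6) (a : 'M[C]_(2, 6)) : jordanC R :=
  let s := ent S in let b := ent26 a in
  let mk qf re := jordan_mk (re (s 0 1)) (re (s 2 3)) (re (s 4 5))
    (Cay (qf (s 0 3) (- s 0 2) (s 1 3) (- s 1 2)) (qf (b 0 4) (b 0 5) (b 1 4) (b 1 5)))
    (Cay (qf (s 2 5) (- s 2 4) (s 3 5) (- s 3 4)) (qf (b 0 0) (b 0 1) (b 1 0) (b 1 1)))
    (Cay (qf (- s 1 4) (s 0 4) (- s 1 5) (s 0 5)) (qf (b 0 2) (b 0 3) (b 1 2) (b 1 3))) in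
  Cplx (mk qre (@complex.Re R)) (mk qim (@complex.Im R)).

Lemma jordanC_ofK X : jordanC_of (skew_part X) (rect_part X) = X.
Proof.
case: X => A B; congr Cplx; apply: jordan_eqP;
  rewrite !jordan_mkE /ent /ent26 !mxE !inordK //=.
all: rewrite ?opprK.
all: try by case: (jordan_val A 0 1) (jordan_val B 0 1)
  => [[????] [????]] [[????] [????]]; congr Cay; congr Quat => /=; field.
all: try by case: (jordan_val A 1 2) (jordan_val B 1 2)
  => [[????] [????]] [[????] [????]]; congr Cay; congr Quat => /=; field.
all: by case: (jordan_val A 2 0) (jordan_val B 2 0) => [[????] [????]] [[????] [????]];
  congr Cay; congr Quat => /=; field.
Qed.

Lemma ord6_ind (P : 'I_6 -> Prop) : P (inord 0) -> P (inord 1) -> P (inord 2) ->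
  P (inord 3) -> P (inord 4) -> P (inord 5) -> forall i, P i.
Proof.
move=> P0 P1 P2 P3 P4 P5 i; rewrite -(inord_val i).
by case: i => [[|[|[|[|[|[|//]]]]]] h].
Qed.

Lemma ord2_ind (P : 'I_2 -> Prop) : P (inord 0) -> P (inord 1) -> forall i, P i.
Proof. by move=> P0 P1 i; rewrite -(inord_val i); case: i => [[|[|//]] h]. Qed.

Definition skewsym (S : 'M[C]_6) : Prop := S^T = - S.

Lemma skewE S i j : skewsym S -> S j i = - S i j.
Proof. by move/matrixP/(_ i j); rewrite !mxE. Qed.

Lemma skew_diag S i : skewsym S -> S i i = 0.
Proof.
by move=> /(skewE i i) h; apply/eqP; rewrite -eqNr -h.
Qed.

Lemma skew_skew_of s : skewsym (skew_of s).
Proof.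
apply/matrixP => i j; rewrite !mxE.
by case: (ltngtP i j) => // _; rewrite ?opprK ?oppr0.
Qed.

Lemma skew_skew_part X : skewsym (skew_part X).
Proof. exact: skew_skew_of. Qed.

Lemma skew_ofE s S : skewsym S ->
  (forall i j, (i < j)%N -> (j < 6)%N -> s i j = S (inord i) (inord j)) -> skew_of s = S.
Proof.
move=> sS h; apply/matrixP => i j; rewrite !mxE.
case: ltngtP => [ij|ij|/val_inj->].
- by rewrite h // !inord_val.
- by rewrite h // !inord_val (skewE i j sS) opprK.
- by rewrite skew_diag.
Qed.

Lemma skew_part_of S a : skewsym S -> skew_part (jordanC_of S a) = S.
Proof.
move=> sS; apply: skew_ofE => // i j ij j6.
have i6 := ltn_trans ij j6.
case: i i6 ij => [|[|[|[|[|[|//]]]]]] _; case: j j6 => [|[|[|[|[|[|//]]]]]] _ //.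
all: rewrite /skew_entry /quat_entry /jordanC_of /cplx_re /cplx_im /diag_entry
  ?jordan_mkE /cay1 ?quatC_entryE ?opprK // /ent.
all: by case: (S _ _).
Qed.

Lemma rect_part_of S a : rect_part (jordanC_of S a) = a.
Proof.
apply/matrixP; elim/ord2_ind; elim/ord6_ind; rewrite mxE !inordK //.
all: by rewrite /rect_entry /e4_entry /jordanC_of /cplx_re /cplx_im ?jordan_mkE /cay2
  ?quatC_entryE.
Qed.

Lemma quatC_entryD q q' r r' u v :
  quatC_entry (q + q') (r + r') u v = quatC_entry q r u v + quatC_entry q' r' u v.
Proof.
case: q q' r r' => [????] [????] [????] [????].
case: u v => [|[|?]] [|[|?]]; rewrite /= ?addr0 //; apply: complex_eq;
  rewrite ?reimE /=; ring.
Qed.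

Lemma quatC_entryZ (c : C) q r u v :
  quatC_entry (complex.Re c *: q - complex.Im c *: r)
    (complex.Re c *: r + complex.Im c *: q) u v = c * quatC_entry q r u v.
Proof.
case: q r c => [????] [????] [c c2].
case: u v => [|[|?]] [|[|?]]; rewrite /= ?mulr0 //; apply: complex_eq;
  rewrite ?reimE /=; ring.
Qed.

Lemma skew_part_linear : linear (@skew_part R).
Proof.
move=> c X Y; apply/matrixP => i j; rewrite !mxE.
suff h k l : skew_entry (c *: X + Y) k l = c * skew_entry X k l + skew_entry Y k l.
  by rewrite !h; case: ltngtP => _; ring.
have hv a b u v : quat_entry (c *: X + Y) a b u v = c * quat_entry X a b u v
  + quat_entry Y a b u v.
  by rewrite /quat_entry -quatC_entryZ -quatC_entryD /= !mxE.
have hd a : diag_entry (c *: X + Y) a = c * diag_entry X a + diag_entry Y a.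
  by rewrite /diag_entry /jordan_diag /= !mxE; case: c {hv} => c c2; apply: complex_eq;
    rewrite ?reimE /=.
rewrite /skew_entry !hv !hd;
  move: (quat_entry X) (quat_entry Y) (diag_entry X) (diag_entry Y) => ????.
by case: k => [|[|[|[|[|k]]]]]; case: l => [|[|[|[|[|[|l]]]]]] /=; ring.
Qed.

Lemma rect_part_linear : linear (@rect_part R).
Proof.
move=> c X Y; apply/matrixP => i j; rewrite !mxE.
have hw a b u v : e4_entry (c *: X + Y) a b u v = c * e4_entry X a b u v
  + e4_entry Y a b u v.
  by rewrite /e4_entry -quatC_entryZ -quatC_entryD /= !mxE.
rewrite /rect_entry !hw; move: (e4_entry X) (e4_entry Y) => ??;
  case: (val j) => [|[|[|[|[|[|?]]]]]] /=; ring.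
Qed.

Lemma skew_part_gamma X : skew_part (jordanC_gamma X) = skew_part X.
Proof.
apply/matrixP => i j; rewrite !mxE.
suff h k l : skew_entry (jordanC_gamma X) k l = skew_entry X k l by rewrite !h.
by rewrite /skew_entry /quat_entry /diag_entry /jordan_diag /= !mxE.
Qed.

Lemma rect_part_gamma X : rect_part (jordanC_gamma X) = - rect_part X.
Proof.
apply/matrixP => i j; rewrite !mxE.
have qCN q r u v : quatC_entry (- q) (- r) u v = - quatC_entry q r u v.
  case: q r => [????] [????].
  by case: u v => [|[|?]] [|[|?]]; rewrite /= ?oppr0 //; apply: complex_eq;
    rewrite ?reimE /=; ring.
have hw a b u v : e4_entry (jordanC_gamma X) a b u v = - e4_entry X a b u v.
  by rewrite /e4_entry -qCN /= !mxE.
rewrite /rect_entry !hw; move: (e4_entry X) => ?;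
  case: (val j) => [|[|[|[|[|[|?]]]]]] /=; ring.
Qed.

End InverseCoordinates.

Section PfaffianSum.
Variable R : realType.
Notation C := R[i].

(** This links the sum over permutations, whose behaviour under congruence is known, to the explicit
    polynomial found in the determinant. *)
Lemma pfsumE (S : 'M[C]_6) : skewsym S -> pfsum S = 48%:R * pf6 S.
Proof.
move=> sS.
have e i j : ent S i j = - ent S j i by exact: skewE.
rewrite /pf6 -(altsum6E e) -altsumE; apply: eq_bigr => s _.
rewrite /ent.
have nthE k : (k < 6)%N -> nth ord0 (enum 'I_6) k = inord k.
  by move=> k6; apply: val_inj; rewrite /= nth_enum_ord // inordK.
by rewrite !(nth_map ord0) -?enumT ?size_enum_ord // !nthE // !inord_val mulrA.
Qed.
End PfaffianSum.

(** * The Hermitian form in matrix coordinates *)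

Section HermitianForm.
Variable R : realType.
Notation C := R[i].
Implicit Types (X Y Z : jordanC R) (q r : quat R).

(** The extension of [cay_dot] to x + ix' and y + iy' that is semilinear in the first argument. *)
Definition hdotC (x x' y y' : cayley R) : C :=
  (cay_dot x y + cay_dot x' y') +i* (cay_dot x y' - cay_dot x' y).

Lemma jordan_innerC (A B : jordan R) : jordan_inner A B = jordan_inner B A.
Proof.
rewrite !jordan_innerE (cay_dotC (val A 0 1)) (cay_dotC (val A 1 2%:R)).
rewrite (cay_dotC (val A 2%:R 0)).
by ring.
Qed.

Lemma jordan_innerNl (A B : jordan R) : jordan_inner (- A) B = - jordan_inner A B.
Proof. by rewrite jordan_innerC jordan_innerNr jordan_innerC. Qed.

Lemma jordanC_herm_polyE X Y : let x i j := val (cplx_re X) i j in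
  let x' i j := val (cplx_im X) i j in
  let y i j := val (cplx_re Y) i j in let y' i j := val (cplx_im Y) i j in
  jordanC_herm X Y = (conjc (diag_entry X 0) * diag_entry Y 0
    + conjc (diag_entry X 1) * diag_entry Y 1
    + conjc (diag_entry X 2%:R) * diag_entry Y 2%:R) + 2 *
   (hdotC (x 0 1) (x' 0 1) (y 0 1) (y' 0 1)
    + hdotC (x 1 2%:R) (x' 1 2%:R) (y 1 2%:R) (y' 1 2%:R)
    + hdotC (x 2%:R 0) (x' 2%:R 0) (y 2%:R 0) (y' 2%:R 0)).
Proof.
case: X Y => [A B] [D E] /=.
rewrite /jordanC_herm /jordanC_inner /cplx_extform /= !jordan_innerNl !jordan_innerE
  /hdotC.
by apply: complex_eq; rewrite /diag_entry complex2E !reimE /=; ring.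
Qed.

Lemma hdotCE x x' y y' :
  let k := quatC_entry (cay1 x) (cay1 x') in
  let h := quatC_entry (cay2 x) (cay2 x') in
  let l := quatC_entry (cay1 y) (cay1 y') in
  let m := quatC_entry (cay2 y) (cay2 y') in
  2 * hdotC x x' y y' =
    (conjc (k 0 0) * l 0 0 + conjc (k 0 1) * l 0 1 + conjc (k 1 0) * l 1 0
      + conjc (k 1 1) * l 1 1)
  + (conjc (h 0 0) * m 0 0 + conjc (h 0 1) * m 0 1 + conjc (h 1 0) * m 1 0
    + conjc (h 1 1) * m 1 1).
Proof.
case: x x' => [[????] [????]] [[????] [????]].
case: y y' => [[????] [????]] [[????] [????]] /=.
by rewrite /hdotC complex2E /cay_dot /cay_re; apply: complex_eq; rewrite !reimE /=; ring.
Qed.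

Lemma conjcN (z : C) : conjc (- z) = - conjc z.
Proof. by case: z. Qed.

(** Each entry above the diagonal of a skew matrix is counted twice by the trace, whence [2^-1] in
    the first term only. *)
Lemma jordanC_hermE X Y : jordanC_herm X Y =
  2^-1 * \tr ((skew_part X) ^t* *m skew_part Y) + \tr ((rect_part X) ^t* *m rect_part Y).
Proof.
have sum2 (F : 'I_2 -> C) : \sum_i F i = F (inord 0) + F (inord 1).
  rewrite !big_ord_recl big_ord0 addr0.
  by congr (_ + _); congr F; apply: val_inj; rewrite /= inordK.
rewrite /skew_part /rect_part.
(* The entry functions are abstracted so that [/=] does not unfold them. *)
move: (erefl (skew_entry X)) (erefl (skew_entry Y)).
move: (erefl (rect_entry X)) (erefl (rect_entry Y)).
move: {1 3}(skew_entry X) {1 3}(skew_entry Y) {1 3}(rect_entry X) {1 3}(rect_entry Y)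
  => s t a b ea eb es et.
rewrite /mxtrace !sum6 !mxE !sum6 !sum2 !mxE !inordK //.
rewrite /= !conjCE !conjcN !conjc0.
rewrite es et ea eb jordanC_herm_polyE; lazy beta zeta.
rewrite !mulrDr !hdotCE;
  lazy beta iota zeta delta [skew_entry rect_entry quat_entry e4_entry].
rewrite !conjcN.
by field.
Qed.

End HermitianForm.

(** * Unitary matrices *)

Section Unitary.
Variable C : numClosedFieldType.

Lemma adjmxM m n p (A : 'M[C]_(m, n)) (B : 'M_(n, p)) : (A *m B)^t* = B^t* *m A^t*.
Proof. by rewrite trmx_mul map_mxM. Qed.

Lemma mulmx_delta_entry m n p q (G : 'M[C]_(m, n)) (H : 'M_(p, q)) u v j i :
  (G *m delta_mx v j *m H) u i = G u v * H j i.
Proof.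
rewrite -(mul_delta_mx (0 : 'I_1)) mulmxA -colE -mulmxA -rowE.
by rewrite mxE big_ord1 !mxE.
Qed.

Lemma mxtrace_delta m n (X : 'M[C]_(m, n)) i u : \tr (delta_mx i u *m X) = X u i.
Proof.
rewrite /mxtrace (bigD1 i) //= big1 ?addr0 => [|k ki];
  rewrite mxE (bigD1 u) //= big1 ?addr0.
- by rewrite mxE !eqxx mul1r.
- by move=> j ju; rewrite mxE (negPf ju) andbF mul0r.
- by rewrite mxE (negPf ki) mul0r.
- by move=> j ju; rewrite mxE (negPf ju) andbF mul0r.
Qed.

Lemma adj_delta m n (u : 'I_m) (i : 'I_n) :
  (delta_mx u i)^t* = delta_mx i u :> 'M[C]_(n, m).
Proof. by rewrite trmx_delta map_delta_mx. Qed.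

(** On matrix units the hypothesis says that [G u v * H j i] is a product of Kronecker deltas, so
    [G] and [H] are scalar with inverse factors. *)
Lemma tensor_unitary m n (P : 'M[C]_m.+1) (Q : 'M[C]_n.+1) :
  (forall a b, \tr ((P *m a *m Q)^t* *m (P *m b *m Q)) = \tr (a^t* *m b)) ->
  exists2 l : C, l != 0 & P^t* *m P = l%:M /\ Q *m Q^t* = l^-1%:M.
Proof.
move=> PQ; set G := P^t* *m P; set H := Q *m Q^t*.
have GH u v i j : G u v * H j i = ((u == v) && (i == j))%:R.
  have := PQ (delta_mx u i) (delta_mx v j).
  rewrite !adjmxM adj_delta mxtrace_delta [in RHS]mxE => <-.
  rewrite -!mulmxA mxtrace_mulC -!mulmxA mxtrace_delta -mulmx_delta_entry.
  by rewrite /G /H !mulmxA.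
have l0 : G 0 0 != 0.
  apply/eqP => G0; have := GH 0 0 0 0; rewrite G0 mul0r !eqxx => /esym/eqP.
  by rewrite oner_eq0.
have H0 : H 0 0 = (G 0 0)^-1.
  by apply: (mulfI l0); rewrite GH divff // mulr1.
exists (G 0 0) => //; split; apply/matrixP => u v; rewrite [RHS]mxE.
  apply: (mulIf (invr_neq0 l0)); rewrite -{1}H0 GH eqxx andbT.
  by case: (u == v); rewrite ?mulr1n ?mulr0n ?mul0r ?divff.
by apply: (mulfI l0); rewrite GH eqxx [u == v]eq_sym; case: (v == u);
  rewrite ?mulr1n ?mulr0n ?mulr0 ?divff.
Qed.

(** The determinant has degree 2 in a 2 x 2 matrix, so dividing [P] by a square root of [\det P]
    makes it 1. The scalar [m] left by [tensor_unitary] then has square 1 and is nonnegative as a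
    diagonal entry of a Gram matrix. *)
Lemma tensor_special_unitary n (P : 'M[C]_2) (Q : 'M[C]_n.+1) :
  (forall a b, \tr ((P *m a *m Q)^t* *m (P *m b *m Q)) = \tr (a^t* *m b)) ->
  exists2 PQ : 'M[C]_2 * 'M[C]_n.+1, suP PQ.1 /\ PQ.2 \is unitarymx &
    forall a, P *m a *m Q = PQ.1 *m a *m PQ.2.
Proof.
move=> hPQ; have [l l0 [Pl _]] := tensor_unitary hPQ.
have d0 : \det P != 0.
  have : \det (P^t* *m P) != 0 by rewrite Pl det_scalar expf_neq0.
  by rewrite det_mulmx mulf_eq0 => /norP[].
pose s := sqrtC (\det P); have s0 : s != 0 by rewrite sqrtC_eq0.
pose P' := s^-1 *: P; pose Q' := s *: Q.
have PQE a : P *m a *m Q = P' *m a *m Q'.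
  by rewrite /P' /Q' -!scalemxAl -scalemxAr scalerA mulVf // scale1r.
have dP' : \det P' = 1.
  by rewrite detZ exprVn sqrtCK mulVf.
have [m m0 [P'm Q'm]] : exists2 l : C,
  l != 0 & P'^t* *m P' = l%:M /\ Q' *m Q'^t* = l^-1%:M.
  by apply: tensor_unitary => a b; rewrite -!PQE.
have m_ge0 : 0 <= m.
  have := congr1 (fun M : 'M_2 => M 0 0) P'm; rewrite !mxE eqxx mulr1n => <-.
  by apply: sumr_ge0 => i _; rewrite !mxE mulrC mul_conjC_ge0.
have m1 : m = 1.
  have := congr1 determinant P'm;
    rewrite det_mulmx det_map_mx det_tr dP' rmorph1 mulr1 det_scalar.
  by move/esym/eqP; rewrite sqrp_eq1 // => /eqP.
exists (P', Q') => //=; split; last by apply/unitarymxP; rewrite Q'm m1 invr1.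
rewrite /suP dP' eqxx andbT; apply/unitarymxP; apply: mulmx1C.
by rewrite P'm m1.
Qed.

End Unitary.

(** * Unit quaternions as SU(2) *)

Section QuaternionMatrices.
Variable R : realType.
Notation C := R[i].

Definition quat_mx (q : quat R) : 'M[C]_2 := \matrix_(u, v) quatC_entry q 0 u v.

Lemma det_mx22 (A : 'M[C]_2) : \det A = A 0 0 * A 1 1 - A 0 1 * A 1 0.
Proof.
rewrite (expand_det_row _ 0) big_ord_recl big_ord1 /cofactor !det_mx11 !mxE /=.
rewrite expr0 mul1r expr1 mulN1r mulrN.
by congr (A _ _ * A _ _ - A _ _ * A _ _); apply: val_inj.
Qed.

Lemma matrix22P (A B : 'M[C]_2) : A 0 0 = B 0 0 -> A 0 1 = B 0 1 -> A 1 0 = B 1 0 ->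
  A 1 1 = B 1 1 -> A = B.
Proof.
have e0 : inord 0 = 0 :> 'I_2 by apply: val_inj; rewrite /= inordK.
have e1 : inord 1 = 1 :> 'I_2 by apply: val_inj; rewrite /= inordK.
by move=> h1 h2 h3 h4; apply/matrixP; elim/ord2_ind; elim/ord2_ind; rewrite ?e0 ?e1.
Qed.

Lemma quat_mxM p q : quat_mx (p * q) = quat_mx p *m quat_mx q.
Proof.
case: p q => [????] [????].
by apply: matrix22P; rewrite !mxE big_ord_recl big_ord1 !mxE /=; apply: complex_eq;
  rewrite ?reimE /=; ring.
Qed.

Lemma quat_mx1 : quat_mx 1 = 1%:M.
Proof. by apply: matrix22P; rewrite !mxE /=; apply: complex_eq; rewrite /=; ring. Qed.

Lemma quat_mx_su (p : Sp1 R) : suP (quat_mx (val p)).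
Proof.
case: p => [[a b c d] /=]; rewrite sp1_eq /= => /eqP e.
apply/andP; split.
  apply/unitarymxP/matrix22P; rewrite !mxE big_ord_recl big_ord1 !mxE /= !conjCE;
  by apply: complex_eq; rewrite ?reimE /= ?mulr1n -?e; ring.
rewrite det_mx22 !mxE /=; apply/eqP.
by apply: complex_eq; rewrite ?reimE /= -?e; ring.
Qed.

Lemma su_quat_mx (P : 'M[C]_2) : suP P -> exists p : Sp1 R, P = quat_mx (val p).
Proof.
case/andP => /unitarymxP PP /eqP dP.
have := mulmx1C PP.
move/matrixP => h; have := h 0 0; have := h 0 1; have := h 1 1; have := h 1 0.
move: dP; rewrite det_mx22 !mxE !big_ord_recl !big_ord0 !mxE /=.
have -> : lift ord0 ord0 = 1 :> 'I_2 by apply: val_inj.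
rewrite !addr0 !conjCE mulr1n mulr0n.
have hP := @matrix22P P; move: hP.
move: (P 0 0) (P 0 1) (P 1 0) (P 1 1) => a b c d hP e h10 h11 h01 h00.
(* The difference is a combination of the column orthonormality relations and of the determinant
   relation; the same holds for [cb]. *)
have da : d = conjc a.
  apply/eqP; rewrite -subr_eq0; apply/eqP;
    transitivity (d * (1 - (conjc a * a + conjc c * c))
    + c * (conjc a * b + conjc c * d) + conjc a * (a * d - b * c - 1)); first by ring.
  by rewrite e h00 h01 !subrr !mulr0 !addr0.
have cb : c = - conjc b.
  apply/eqP; rewrite -addr_eq0; apply/eqP;
    transitivity (c * (1 - (conjc b * b + conjc d * d))
    + d * (conjc b * a + conjc d * c) - conjc b * (a * d - b * c - 1)); first by ring.
  by rewrite e h10 h11 !subrr !mulr0 !addr0 subr0.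
have ps : sp1P (Quat (complex.Re a) (complex.Im a) (complex.Re b) (complex.Im b)).
  rewrite sp1_eq /=; apply/eqP; have := congr1 (@complex.Re R) e.
  by rewrite da cb; case: (a) (b) => [? ?] [? ?]; rewrite ?reimE /= => <-; ring.
exists (Sub _ ps); apply: hP; rewrite !mxE /= ?da ?cb; apply: complex_eq;
  rewrite ?reimE /=.
all: by case: (a) (b) => [? ?] [? ?] /=; ring.
Qed.
End QuaternionMatrices.

(** * The action of Sp(1) x SU(6) *)

(** The first isomorphism theorem, with the map going from [H] to the quotient by a choice of
    preimages; [phi_eq] makes the class independent of the choice. *)
Lemma quot_isomorphic (G H : groupType) (N : normalSubgroup G) (phi : G -> H) :
  {morph phi : x y / (x * y)%g} -> (forall y, exists x, phi x = y) ->
  (forall x, phi x = 1%g <-> x \in N) -> group_isomorphic H (quot_group N).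
Proof.
move=> phiM phi_surj phi_ker.
have phi1 : phi 1%g = 1%g by apply: (@mulgI _ (phi 1%g)); rewrite -phiM !mulg1.
have phiV x : phi x^-1%g = (phi x)^-1%g.
  by apply: (@mulgI _ (phi x)); rewrite -phiM !mulgV.
have phi_eq x y : phi x = phi y <-> \pi_(quot_group N) x = \pi_(quot_group N) y.
  split=> [e|/quot_piP/phi_ker].
    by apply/quot_piP/phi_ker; rewrite phiM phiV e mulVg.
  by rewrite phiM phiV => e; apply: (@mulgI _ (phi x)^-1%g); rewrite e mulVg.
pose s y := projT1 (cid (phi_surj y)).
have sK y : phi (s y) = y by rewrite /s; case: cid.
pose f y := \pi_(quot_group N) (s y).
have fM : {morph f : x y / (x * y)%g}.
  move=> x y; transitivity (\pi_(quot_group N) (s x * s y)%g).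
    by apply/phi_eq; rewrite phiM !sK.
  exact/esym/quot_mul_pi.
pose fm : {multiplicative H -> quot_group N} :=
  HB.pack f (isMultiplicative.Build _ _ f fM).
exists fm; exists (fun q => phi (repr q)) => [y|q] /=.
  by rewrite -[RHS]sK; apply/phi_eq; rewrite reprK.
by rewrite -[RHS]reprK; apply/phi_eq; rewrite sK.
Qed.

Section Phi.
Variable R : realType.
Notation C := R[i].
Implicit Types (X Y Z : jordanC R) (x y : (Sp1 R * SU R[i] 6)%type).

Lemma jordanC_parts_inj X Y : skew_part X = skew_part Y -> rect_part X = rect_part Y ->
  X = Y.
Proof. by move=> e1 e2; rewrite -(jordanC_ofK X) e1 e2 jordanC_ofK. Qed.

Lemma skew_cong m (A : 'M[C]_(m, 6)) (S : 'M[C]_6) : skewsym S ->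
  (A *m S *m A^T)^T = - (A *m S *m A^T).
Proof. by move=> sS; rewrite !trmx_mul trmxK sS !(mulmxN, mulNmx) mulmxA. Qed.

Lemma pf6_cong (A S : 'M[C]_6) : skewsym S -> pf6 (A *m S *m A^T) = \det A * pf6 S.
Proof.
move=> sS; have n0 : (48%:R : C) != 0 by rewrite pnatr_eq0.
apply: (mulfI n0); rewrite -pfsumE; last exact: skew_cong.
by rewrite pfsum_cong pfsumE // mulrCA.
Qed.

(** The analogue of [pf6_cong] in size 2, where the Pfaffian is the entry (0, 1). *)
Lemma skew2_cong (P M : 'M[C]_2) : M^T = - M -> (P *m M *m P^T) 0 1 = \det P * M 0 1.
Proof.
move/matrixP=> h; have := h 0 0; have := h 0 1; have := h 1 1.
rewrite !mxE det_mx22 !(big_ord_recl, big_ord0, mxE).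
have -> : lift ord0 ord0 = 1 :> 'I_2 by apply: val_inj.
have e (z : C) : z = - z -> z = 0 by move=> zN; apply/eqP; rewrite -eqNr -zN.
by move=> /e-> -> /e->; ring.
Qed.

Definition phi_fun x X : jordanC R :=
  jordanC_of (val x.2 *m skew_part X *m (val x.2)^T)
    (quat_mx (val x.1) *m rect_part X *m (val x.2)^t*).

Lemma skew_part_phi x X : skew_part (phi_fun x X) = val x.2 *m skew_part X *m (val x.2)^T.
Proof. by rewrite skew_part_of //; apply/skew_cong/skew_skew_part. Qed.

Lemma rect_part_phi x X :
  rect_part (phi_fun x X) = quat_mx (val x.1) *m rect_part X *m (val x.2)^t*.
Proof. exact: rect_part_of. Qed.

Lemma phi_funM x y X : phi_fun (x * y)%g X = phi_fun x (phi_fun y X).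
Proof.
apply: jordanC_parts_inj; rewrite ?skew_part_phi ?rect_part_phi /=.
  by rewrite trmx_mul !mulmxA.
by rewrite quat_mxM adjmxM !mulmxA.
Qed.

Lemma phi_fun1 X : phi_fun 1%g X = X.
Proof.
apply: jordanC_parts_inj; rewrite ?skew_part_phi ?rect_part_phi /=.
  by rewrite trmx1 mulmx1 mul1mx.
by rewrite quat_mx1 trmx1 map_mx1 mulmx1 mul1mx.
Qed.

Lemma phi_lin_aut x : lin_autP (phi_fun x).
Proof.
apply/asboolP; split; last first.
  exists (phi_fun x^-1%g) => X; first by rewrite -phi_funM mulVg phi_fun1.
  by rewrite -phi_funM mulgV phi_fun1.
move=> c X Y; apply: jordanC_parts_inj.
  rewrite skew_part_phi [in LHS]skew_part_linear [RHS]skew_part_linear !skew_part_phi.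
  by rewrite mulmxDr mulmxDl -scalemxAr -scalemxAl.
rewrite rect_part_phi [in LHS]rect_part_linear [RHS]rect_part_linear !rect_part_phi.
by rewrite mulmxDr mulmxDl -scalemxAr -scalemxAl.
Qed.

Definition phi_lin x : lin_aut (jordanC R) := Sub (phi_fun x) (phi_lin_aut x).

Lemma suK (A : SU C 6) : (val A)^t* *m val A = 1%:M.
Proof. exact: (congr1 val (su_mulVx A)). Qed.

Lemma mxtrace_unitary m n (U : 'M[C]_m) (V : 'M[C]_n) (a b : 'M[C]_(m, n)) :
  U^t* *m U = 1%:M -> V *m V^t* = 1%:M ->
  \tr ((U *m a *m V)^t* *m (U *m b *m V)) = \tr (a^t* *m b).
Proof.
move=> UU VV; rewrite !adjmxM -!mulmxA mxtrace_mulC -!mulmxA.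
by rewrite VV mulmx1 (mulmxA (U^t*)) UU mul1mx.
Qed.

Lemma phi_e6 x : phi_lin x \in @e6P R.
Proof.
case: x => p A; have AA := suK A; have /andP[/unitarymxP PP /eqP dP] := quat_mx_su p.
have /andP[/unitarymxP AA' /eqP dA] := valP A.
rewrite unfold_in; apply/asboolP; split=> [X|X Y].
  rewrite -[phi_lin _ X]/(phi_fun (p, A) X).
  rewrite !jordanC_detE skew_part_phi rect_part_phi /= pf6_cong;
    last exact: skew_skew_part.
  rewrite dA mul1r; congr (_ - _).
  set a := rect_part X; set S := skew_part X; set U := val A in AA *.
  (* Unitarity cancels [U] in the middle, so only the congruence by the quaternion matrix, of
     determinant 1, remains. *)
  have -> : quat_mx (val p) *m a *m U^t* *m (U *m S *m U^T) *m
      (quat_mx (val p) *m a *m U^t*)^T =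
      quat_mx (val p) *m (a *m S *m a^T) *m (quat_mx (val p))^T.
    have e : U^T *m (U^t*)^T = 1%:M by rewrite -trmx_mul AA trmx1.
    by rewrite !trmx_mul !mulmxA -(mulmxA (quat_mx _ *m a)) AA mulmx1 -(mulmxA (_ *m
      S)) e mulmx1.
  by rewrite skew2_cong ?dP ?mul1r //; apply/skew_cong/skew_skew_part.
rewrite -[phi_lin _ X]/(phi_fun (p, A) X) -[phi_lin _ Y]/(phi_fun (p, A) Y).
rewrite (jordanC_hermE (phi_fun _ X)) (jordanC_hermE X) !skew_part_phi !rect_part_phi;
  congr (_ * _ + _).
  apply: mxtrace_unitary => //.
  apply: (can_inj (@trmxK _ _ _)); rewrite trmx_mul trmxK trmx1 -AA; congr (_ *m _).
  by apply/matrixP => i j; rewrite !mxE.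
apply: mxtrace_unitary; first exact: mulmx1C.
by rewrite trmxCK.
Qed.

Definition phi_E6 x : E6 R := Sub (phi_lin x) (phi_e6 x).

Lemma phi_gamma x : phi_E6 x \in centralizer (gamma_E6 R).
Proof.
rewrite inE; apply/eqP/val_inj/val_inj/funext => X /=.
apply: jordanC_parts_inj;
  rewrite ?skew_part_phi ?rect_part_phi ?skew_part_gamma ?rect_part_gamma
    ?skew_part_phi //.
by rewrite rect_part_phi mulmxN mulNmx.
Qed.

Definition phi x : E6gamma R := Sub (phi_E6 x) (phi_gamma x).

Lemma phiM : {morph phi : x y / (x * y)%g}.
Proof. by move=> x y; do 3!apply: val_inj; apply/funext => X; apply: phi_funM. Qed.

End Phi.

(** * Every element of the centralizer comes from Sp(1) x SU(6) *)

Section Main.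
Variable R : realType.
Notation C := R[i].
Implicit Types (X Y Z : jordanC R) (x y : (Sp1 R * SU R[i] 6)%type).

Lemma skewsym0 : skewsym (0 : 'M[C]_6).
Proof. by rewrite /skewsym linear0 oppr0. Qed.

(** Vanishing minors make [a 0 j * a 1 i] symmetric in i and j, and its contraction with a skew
    matrix is its own negative. *)
Lemma minors0_skew (a : 'M[C]_(2, 6)) (S : 'M[C]_6) : skewsym S -> minors0 a ->
  (a *m S *m a^T) 0 1 = 0.
Proof.
move=> sS ma; set x := LHS.
suff xN : x = - x by apply/eqP; rewrite -eqNr -xN.
have xE : x = \sum_i \sum_j S j i * (a 0 j * a 1 i).
  rewrite /x mxE; apply: eq_bigr => i _; rewrite !mxE big_distrl.
  by apply: eq_bigr => j _; rewrite /= mulrAC mulrC.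
rewrite {1}xE exchange_big xE -sumrN; apply: eq_bigr => i _.
rewrite -sumrN; apply: eq_bigr => j _.
by rewrite (skewE i j sS) mulNr opprK; congr (_ * _); have := ma j i; rewrite !mxE => ->.
Qed.

(** On [delta_mx i j - delta_mx j i] the form is the minor of columns i and j. *)
Lemma minors0_of_skew (a : 'M[C]_(2, 6)) :
  (forall S, skewsym S -> (a *m S *m a^T) 0 1 = 0) -> minors0 a.
Proof.
move=> h i j; rewrite !mxE; pose S : 'M[C]_6 := delta_mx i j - delta_mx j i.
have sS : skewsym S by rewrite /skewsym linearB /= !trmx_delta opprB.
have := h S sS; rewrite mulmxBr mulmxBl.
rewrite mxE [(- _ : 'M__) _ _]mxE !mulmx_delta_entry !mxE => /eqP.
by rewrite subr_eq0 => /eqP.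
Qed.

Lemma skew_form_inj (N : 'M[C]_6) :
  (forall a : 'M[C]_(2, 6), (a *m N *m a^T) 0 1 = 0) -> N = 0.
Proof.
move=> h; apply/matrixP => i j; rewrite mxE.
have := h (rows2 (delta_mx 0 i) (delta_mx 0 j)).
have e u v (a : 'M[C]_(2, 6)) : (a *m N *m a^T) u v = (row u a *m N *m (row v a)^T) 0 0.
  rewrite !mxE; apply: eq_bigr => k _; rewrite !mxE; congr (_ * _).
  by apply: eq_bigr => l _; rewrite mxE.
rewrite e row0_rows2 row1_rows2 -rowE trmx_delta.
by rewrite -colE !mxE.
Qed.

Lemma jordanC_of_gamma (S : 'M[C]_6) (a : 'M[C]_(2, 6)) : skewsym S ->
  jordanC_gamma (jordanC_of S a) = jordanC_of S (- a).
Proof.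
by move=> sS; apply: jordanC_parts_inj;
  rewrite ?skew_part_gamma ?rect_part_gamma ?skew_part_of ?rect_part_of.
Qed.

Lemma jordanC_of_linear (c : C) (S S' : 'M[C]_6) (a a' : 'M[C]_(2, 6)) :
  skewsym S -> skewsym S' ->
  jordanC_of (c *: S + S') (c *: a + a') = c *: jordanC_of S a + jordanC_of S' a'.
Proof.
move=> sS sS'; have sS'' : skewsym (c *: S + S').
  by rewrite /skewsym linearP /= sS sS' opprD scalerN.
apply: jordanC_parts_inj; first by rewrite [RHS]skew_part_linear !skew_part_of.
by rewrite [RHS]rect_part_linear !rect_part_of.
Qed.

Lemma skew_partD X Y : skew_part (X + Y) = skew_part X + skew_part Y.
Proof. by have := skew_part_linear 1 X Y; rewrite !scale1r. Qed.

Lemma rect_partD X Y : rect_part (X + Y) = rect_part X + rect_part Y.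
Proof. by have := rect_part_linear 1 X Y; rewrite !scale1r. Qed.

Lemma skew_partN X : skew_part (- X) = - skew_part X.
Proof.
apply: (addrI (skew_part X)); rewrite -skew_partD !subrr.
by apply: (addrI (skew_part 0)); rewrite -skew_partD !addr0.
Qed.

Lemma rect_partN X : rect_part (- X) = - rect_part X.
Proof.
apply: (addrI (rect_part X)); rewrite -rect_partD !subrr.
by apply: (addrI (rect_part 0)); rewrite -rect_partD !addr0.
Qed.

Lemma mx_eqN m n (M : 'M[C]_(m, n)) : M = - M -> M = 0.
Proof.
move=> e; apply/matrixP => i j; move/matrixP/(_ i j): e; rewrite !mxE => e.
by apply/eqP; rewrite -eqNr -e.
Qed.

Section Surjectivity.
Variable f : jordanC R -> jordanC R.
Hypotheses (lin_f : linear f) (bij_f : bijective f).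
Hypothesis det_f : forall X, jordanC_det (f X) = jordanC_det X.
Hypothesis herm_f : forall X Y, jordanC_herm (f X) (f Y) = jordanC_herm X Y.
Hypothesis gamma_f : forall X, jordanC_gamma (f X) = f (jordanC_gamma X).

(** [V] and [W] restrict [f] to the eigenspaces of gamma; [V_even] and [W_odd] show that the blocks
    [B] and [D] describe [f] completely. *)
Let V (S : 'M[C]_6) := f (jordanC_of S 0).
Let W (a : 'M[C]_(2, 6)) := f (jordanC_of 0 a).
Let B S := skew_part (V S).
Let D a := rect_part (W a).

Let fN X : f (- X) = - f X.
Proof.
have f0 : f 0 = 0 by have := lin_f (-1) 0 0; rewrite scaler0 add0r scaleN1r addNr.
by have := lin_f (-1) X 0; rewrite !scaleN1r f0 !addr0.
Qed.

Let fD X Y : f (X + Y) = f X + f Y.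
Proof. by have := lin_f 1 X Y; rewrite !scale1r. Qed.

Let f_of S a : skewsym S -> f (jordanC_of S a) = V S + W a.
Proof.
move=> sS; have := jordanC_of_linear 1 0 a sS skewsym0.
by rewrite !scale1r addr0 add0r => ->; rewrite fD.
Qed.

Let V_even S : skewsym S -> rect_part (V S) = 0.
Proof.
move=> sS; have := rect_part_gamma (V S).
by rewrite gamma_f jordanC_of_gamma // oppr0 => /mx_eqN.
Qed.

Let W_odd a : skew_part (W a) = 0.
Proof.
have e : jordanC_gamma (W a) = - W a.
  rewrite gamma_f jordanC_of_gamma; last exact: skewsym0.
  by rewrite -fN; congr f; apply: jordanC_parts_inj;
    rewrite ?skew_partN ?rect_partN ?skew_part_of ?rect_part_of ?oppr0 //;
      exact: skewsym0.
by have := skew_part_gamma (W a); rewrite e skew_partN => /esym/mx_eqN.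
Qed.

Let det_BD S a : skewsym S ->
  pf6 (B S) - (D a *m B S *m (D a)^T) 0 1 = pf6 S - (a *m S *m a^T) 0 1.
Proof.
move=> sS; have := det_f (jordanC_of S a); rewrite f_of // !jordanC_detE.
by rewrite skew_partD rect_partD W_odd V_even // addr0 add0r skew_part_of // rect_part_of.
Qed.

(** The case [a = 0] of [det_BD] isolates the Pfaffian; subtracting it gives [form_BD]. *)
Let pf_B S : skewsym S -> pf6 (B S) = pf6 S.
Proof.
move=> sS; have W0 : D 0 = 0.
  apply: mx_eqN; rewrite {2}/D -rect_partN -fN /D /W; congr (rect_part (f _));
    apply: jordanC_parts_inj;
    by rewrite ?skew_partN ?rect_partN ?skew_part_of ?rect_part_of ?oppr0 //;
      exact: skewsym0.
by have := det_BD 0 sS; rewrite W0 !mul0mx mxE !subr0.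
Qed.

Let form_BD S a : skewsym S -> (D a *m B S *m (D a)^T) 0 1 = (a *m S *m a^T) 0 1.
Proof.
by move=> sS; have := det_BD a sS; rewrite pf_B // => /addrI/oppr_inj.
Qed.

Let B_surj S : skewsym S -> exists2 S', skewsym S' & B S' = S.
Proof.
move=> sS; case: bij_f => g _ gK; exists (skew_part (g (jordanC_of S 0)));
  first exact: skew_skew_part.
have := gK (jordanC_of S 0); rewrite -{1}(jordanC_ofK (g _)) f_of;
  last exact: skew_skew_part.
by move/(congr1 (@skew_part R)); rewrite skew_partD W_odd addr0 skew_part_of.
Qed.

Let D_minors0 a : minors0 a -> minors0 (D a).
Proof.
move=> ma; apply: minors0_of_skew => S /B_surj[S' sS' <-].
by rewrite form_BD //; apply: minors0_skew.
Qed.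

Let D_inj : injective D.
Proof.
move=> a b e; have : W a = W b by apply: jordanC_parts_inj; rewrite ?W_odd.
by move/(bij_inj bij_f)/(congr1 (@rect_part R)); rewrite !rect_part_of.
Qed.

Let D_linear : linear D.
Proof.
move=> c a b; rewrite /D /W -rect_part_linear -lin_f; congr (rect_part (f _)).
rewrite -jordanC_of_linear ?scaler0 ?addr0 //; exact: skewsym0.
Qed.

Let D_herm a b : \tr ((D a)^t* *m D b) = \tr (a^t* *m b).
Proof.
have := herm_f (jordanC_of 0 a) (jordanC_of 0 b).
rewrite !jordanC_hermE -/(W a) -/(W b) !W_odd !skew_part_of ?rect_part_of;
  try exact: skewsym0.
by rewrite !mulmx0 mxtrace0 mulr0 !add0r.
Qed.

Lemma phi_fun_surj : exists x, forall X, f X = phi_fun x X.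
Proof.
pose DL : {linear 'M[C]_(2, 6) -> 'M[C]_(2, 6)} :=
  HB.pack D (GRing.isLinear.Build _ _ _ _ D D_linear).
have [P [Q DPQ]] := minors0_preserver (D := DL) isT D_inj D_minors0.
have hPQ a b : \tr ((P *m a *m Q)^t* *m (P *m b *m Q)) = \tr (a^t* *m b).
  by rewrite -!DPQ; apply: D_herm.
have [[P1 Q1] /= [sP uQ] PQE] := tensor_special_unitary hPQ.
have [p pE] := su_quat_mx sP; pose A := Q1^t*.
have AA : A *m A^t* = 1%:M.
  by apply/unitarymxP; rewrite trmxC_unitary.
have DE a : D a = quat_mx (val p) *m a *m A^t*.
  by rewrite -[D a]/(DL a) DPQ PQE pE /A trmxCK.
have BE S : skewsym S -> B S = A *m S *m A^T.
  move=> sS; have sN : skewsym (A^t* *m B S *m (A^t*)^T).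
    exact/skew_cong/skew_skew_part.
  (* Both sides induce the same form on all [a]: by [form_BD] and [DE] they differ by the factor
     [\det (quat_mx (val p))], which is 1. *)
  suff e : A^t* *m B S *m (A^t*)^T = S.
    by rewrite -[in RHS]e !mulmxA AA mul1mx -mulmxA -trmx_mul AA trmx1 mulmx1.
  apply/eqP; rewrite -subr_eq0; apply/eqP/skew_form_inj => a.
  rewrite mulmxBr mulmxBl mxE [(- _ : 'M__) _ _]mxE -(form_BD a sS) DE.
  apply/eqP; rewrite subr_eq0; apply/eqP.
  have /andP[_ /eqP dP] := quat_mx_su p.
  rewrite -[LHS]mul1r -dP -skew2_cong; last exact: skew_cong.
  by rewrite !trmx_mul !mulmxA.
have dA : \det A = 1.
  (* Above the diagonal, [s] is 1 at (0, 1), (2, 3), (4, 5) and 0 elsewhere, so the Pfaffian is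
     1. *)
  pose s (i j : nat) : C := (odd j && (j == i.+1)%N)%:R.
  have sS := skew_skew_of s.
  have := pf_B sS; rewrite BE // pf6_cong //.
  have -> : pf6 (skew_of s) = 1 by rewrite /pf6 /pf_entries /ent !mxE !inordK // /s /=;
    ring.
  by rewrite mulr1.
have sA : suP A by apply/andP; split; [apply/unitarymxP|apply/eqP].
exists (p, Sub A sA) => X; have sX := skew_skew_part X.
rewrite -{1}(jordanC_ofK X) f_of //.
apply: jordanC_parts_inj; rewrite ?skew_partD ?rect_partD ?skew_part_phi ?rect_part_phi.
  by rewrite W_odd addr0 -BE.
by rewrite V_even // add0r -DE.
Qed.

End Surjectivity.
End Main.

(** * The kernel and the quotient *)

Section Final.
Variable R : realType.
Notation C := R[i].

Lemma phi_surj (y : E6gamma R) : exists x, phi x = y.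
Proof.
case: y => [[f fe6] fg]; have := fe6; rewrite unfold_in => /asboolP[det_f herm_f].
have := fg; rewrite inE => /eqP gf.
have gamma_f X : jordanC_gamma (f X) = f (jordanC_gamma X).
  by have /(congr1 (fun h : E6 R => val (val h) X)) := gf.
have [x xE] := phi_fun_surj (@lin_aut_linear _ _ f) (lin_aut_bij f) det_f herm_f gamma_f.
by exists x; do 3!apply: val_inj; apply/funext => X; exact/esym/xE.
Qed.

(** A kernel element satisfies [p a = a A] for all [a]; on matrix units this forces both to be the
    same scalar, which is real because it is a quaternion, and is 1 or -1 because of its norm. *)
Lemma phi_ker (x : (Sp1 R * SU R[i] 6)%type) : phi x = 1%g <-> x \in Z2 R.
Proof.
split=> [e|]; last first.
  rewrite !inE => /orP[]/eqP->; do 3!apply: val_inj; apply/funext => X /=;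
    first exact: phi_fun1.
  apply: jordanC_parts_inj; rewrite ?skew_part_phi ?rect_part_phi /=.
    by rewrite linearN /= trmx1 mulNmx mulmxN mulNmx mulmx1 mul1mx opprK.
  have -> : quat_mx (-1) = - 1%:M :> 'M[C]_2.
    by apply: matrix22P; rewrite !mxE /=; apply: complex_eq; rewrite /=; ring.
  by rewrite linearN /= map_mxN trmx1 map_mx1 mulNmx mulmxN mulNmx mulmx1 mul1mx opprK.
case: x e => p A e; have h (a : 'M[C]_(2, 6)) : quat_mx (val p) *m a = a *m val A.
  have /(congr1 (fun h : E6gamma R =>
    rect_part (val (val (val h)) (jordanC_of 0 a)))) := e.
  rewrite [X in X = _]rect_part_phi !rect_part_of /= => e'.
  by rewrite -[in RHS]e' -!mulmxA suK mulmx1.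
have PA u j r k : quat_mx (val p) r u * (j == k)%:R = (r == u)%:R * val A j k.
  have : (quat_mx (val p) *m delta_mx u j *m 1%:M) r k
    = (1%:M *m delta_mx u j *m val A) r k.
    by rewrite mulmx1 mul1mx h.
  by rewrite !mulmx_delta_entry [1%:M j k]mxE [1%:M r u]mxE.
case: p PA {e h} => [[q0 q1 q2 q3] /= ps] PA.
(* The vanishing off-diagonal entry gives [q2 = q3 = 0], and the equality of the two diagonal
   entries gives [q1 = - q1]. *)
have P01 := PA 1 0 0 0; have P00 := PA 0 0 0 0; have P11 := PA 1 0 1 0.
move: P01 P00 P11; rewrite !eqxx !mulr1 !mul1r mul0r !mxE /= => -[e2 e3] <- [e01 e1].
move: e2 e3 e01 e1; rewrite !subr0 !add0r => e2 e3 _ e1.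
have q1_0 : q1 = 0 by apply/eqP; rewrite -eqNr e1.
move: ps PA; rewrite e2 e3 q1_0 => ps PA.
have qsq : (q0 == 1) || (q0 == -1).
  by move: (ps); rewrite sp1_eq /= !expr0n /= !addr0 sqrf_eq1.
have AE : val A = q0%:C%:M.
  apply/matrixP => j k; have := PA 0 j 0 k; rewrite eqxx mul1r => <-.
  by rewrite mulr_natr !mxE /= subr0 addr0.
rewrite !inE; case/orP: qsq => /eqP q0E; rewrite q0E in AE ps PA *.
  by apply/orP; left; apply/eqP; congr pair; apply: val_inj.
apply/orP; right; apply/eqP; congr pair; apply: val_inj => /=; first by congr Quat;
  rewrite oppr0.
by rewrite AE rmorphN rmorph1 raddfN.
Qed.

End Final.

Theorem theorem3p11p4 (R : realType) :
  group_isomorphic (E6gamma R)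
    (quot_group (G := (Sp1 R * SU R[i] 6)%type) (Z2 R)).
Proof. exact: quot_isomorphic (@phiM R) (@phi_surj R) (@phi_ker R). Qed.
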